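(* Let $\zeta_{TM}:0\mapsto01,\ 1\mapsto10$ be the Thue-Morse substitution with subshift $X_{\zeta_{TM}}$. Let $t\geq0$ be an integer, let $a_1<\dots<a_t$ be positive integers, and for $\mathbf{x}\in X_{\zeta_{TM}}$ let $C^{\pm}_N(a_1,\dots,a_t,\omega,\mathbf{x})$ be the twisted correlation of $F=\mathds{1}_{[0]}-\mathds{1}_{[1]}$ at $\mathbf{x}$. 1. If $t$ is even, there exists $B>0$, independent of $\omega$ and $t$, such that for Lebesgue almost every $\omega\in[0,1)$ and every $\mathbf{x}\in X_{\zeta_{TM}}$, $$C^{\pm}_N(a_1,\dots,a_t,\omega,\mathbf{x})=O_{a_t,\omega}\left(\log(N)^{t+1}e^{B\sqrt{\log(N)\log\log\log(N)}}\right).$$ 2. If $t$ is odd, then for every $\epsilon>0$ and Lebesgue almost every $\omega\in[0,1)$, for every $\mathbf{x}\in X_{\zeta_{TM}}$, $$C^{\pm}_N(a_1,\dots,a_t,\omega,\mathbf{x})=O_{a_t,\omega}\left(\log(N)^{t+2+\epsilon}\right).$$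
   Context: The subshift $X_{\zeta_{TM}}$ is the set of $(x_n)_{n\in\mathbb{Z}}\in\{0,1\}^{\mathbb{Z}}$ all of whose finite subwords are subwords of some $\zeta_{TM}^n(a)$, $a\in\{0,1\}$, $n\in\mathbb{N}$; $T$ is the left shift. $\mathds{1}_{[a]}(\mathbf{x})$ equals $1$ if $x_0=a$ and $0$ otherwise, so $F(\mathbf{x})=(-1)^{x_0}$. With $e(x)=e^{2\pi i x}$, the twisted correlation is $$C^{\pm}_N(a_1,\dots,a_t,\omega,\mathbf{x})=\sum_{k=0}^{N-1}F(T^k\mathbf{x})F(T^{k+a_1}\mathbf{x})\cdots F(T^{k+a_t}\mathbf{x})\,e(k\omega).$$ For $t=0$ it is $\sum_{k=0}^{N-1}F(T^k\mathbf{x})e(k\omega)$ (the twisted Birkhoff sum). $O_{a_t,\omega}(G(N))$ denotes a quantity bounded in absolute value by $C\,G(N)$ for all integers $N\geq16$, where $C>0$ depends only on $a_t$ and $\omega$ (only on $\omega$ if $t=0$), and in the odd case, where $\epsilon$ is fixed first, possibly on $\epsilon$; in particular $C$ does not depend on $\mathbf{x}$. *)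

(* Defs.v *)
From HB Require Import structures.
From mathcomp Require Import all_boot all_order all_algebra.
From mathcomp Require Import all_classical all_reals all_analysis.
From mathcomp.real_closed Require Export complex.

Set Implicit Arguments.
Unset Strict Implicit.
Unset Printing Implicit Defensive.

Import Order.TTheory GRing.Theory Num.Theory.
Import numFieldNormedType.Exports.

Local Open Scope classical_set_scope.
Local Open Scope ring_scope.
Local Open Scope complex_scope.

Section Subshift.
Variable A : eqType.

Definition subst_word (zeta : A -> seq A) (w : seq A) : seq A :=
  flatten (map zeta w).

Definition factor (x : int -> A) (i : int) (n : nat) : seq A :=
  [seq x (i + k%:Z) | k <- iota 0 n].

Definition subshift (zeta : A -> seq A) : set (int -> A) :=
  [set x | forall (i : int) (n : nat), exists (m : nat) (a : A),
     infix (factor x i n) (iter m (subst_word zeta) [:: a])].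

Definition left_shift (x : int -> A) : int -> A := fun n => x (n + 1).

Definition cylinder (a : A) : set (int -> A) := [set x | x 0 = a].

End Subshift.

(* The alphabet {0, 1} is encoded as bool, with 0 = false and 1 = true. *)
Definition zeta_TM (a : bool) : seq bool :=
  if a then [:: true; false] else [:: false; true].

Definition F {R : realType} : (int -> bool) -> R :=
  \1_(cylinder false) \- \1_(cylinder true).

Definition e {R : realType} (x : R) : R[i] :=
  cos (2 * pi * x) +i* sin (2 * pi * x).

Definition twisted_correlation {R : realType} (N : nat) (a : seq nat) (w : R)
    (x : int -> bool) : R[i] :=
  \sum_(0 <= k < N)
    (F (iter k (@left_shift bool) x)
     * \prod_(j <- a) F (iter (k + j) (@left_shift bool) x))%:C * e (k%:R * w).

(* Main.v *)
Require Import Defs.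
From HB Require Import structures.
From mathcomp Require Import all_boot all_order all_algebra.
From mathcomp Require Import all_classical all_reals all_analysis.
From mathcomp Require Import ring lra zify.

Import Order.TTheory GRing.Theory Num.Theory.
Import numFieldNormedType.Exports.
Import ComplexField.Normc.

Local Open Scope classical_set_scope.
Local Open Scope ring_scope.
Local Open Scope complex_scope.

(** The Thue-Morse sequence [tm] satisfies [tm (2l+r) = tm l + r] modulo 2, and
every window of a point of the subshift is, up to a global flip, a window of
[tm].  Hence a twisted correlation has the same modulus as an exponential sum
[tm_sum A p q w] over a window [p, q) of [tm], [A] being the list of shifts, and
bounds that are uniform in [p] are uniform in the point.

Splitting such a sum by the parity of the summation index gives two sums over a
window of half the length, at frequency [2w], whose shifts [a] have become
[(r + a)./2].  After finitely many steps all shifts are 0 or 1, the parity of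
their number being preserved, and coincident shifts cancel in pairs
([tm_bounded_reduction]).

Odd number of factors: only the plain twisted Birkhoff sum remains.  It
satisfies [|S_N(w)| <= 2 + |1 - e(w)| |S_(N/2)(2w)|], so that it is at most
twice a sum of [log N] products [chord_prod j w] of the [|1 - e(2^i w)|], i < j
([tm_sum_single_bound]).  Such a product is the exponential of a Birkhoff sum of
the centred function [log |1 - e(w)|] for the doubling map, and what is needed is
the upper half of a law of the iterated logarithm.  It follows from
sub-Gaussian moments, [E (chord_prod n)^l <= 7 exp (26 l^2 n)]
([mean_chord_prod_powR]), by a dyadic chaining argument
([dyadic_chaining], [ae_sqrt_growth]).  The moments come from the transfer
operator: the explicit function [3 + |1 - e(w)|^(4l)] is multiplied by at most
[1 + 26 l^2] under the operator weighted by [|1 - e(w)|^l] ([transfer_ineq]).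

Even number of factors: the empty product and the product of the shifts 0 and 1
remain.  The first is a geometric sum, and the second reduces to geometric sums
along the orbit of [w], which gives [sum_(j < log N) 1 / |1 - e(2^j w)|]
([tm_sum_pair_bound]).  For almost every [w] the orbit satisfies
[|1 - e(2^j w)| >= c / (j+1)^2] ([ae_slow_return]), and the sum is
[O((log N)^3)].

Almost sure statements are obtained from one principle: nonnegative functions
with summable means are almost everywhere bounded ([ae_bounded]).  Finally there
are only finitely many increasing lists of shifts with a given last entry, so
that the constants of all of them are dominated by one constant depending on that
entry and on [w] ([uniform_constant]). *)

(** * The Thue-Morse sequence and windows of points of the subshift *)

(** Sum of the [f] lowest binary digits of [k], modulo 2. *)
Fixpoint tm_upto (f k : nat) : bool :=
  if f is f'.+1 then odd k (+) tm_upto f' k./2 else false.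

Definition tm (k : nat) : bool := tm_upto k k.

Lemma tm_upto0 f : tm_upto f 0 = false.
Proof. by elim: f. Qed.

Lemma tm_upto_stable f g k :
  (k <= f)%N -> (k <= g)%N -> tm_upto f k = tm_upto g k.
Proof.
elim: f g k => [|f IH] [|g] [|k] //=; rewrite ?tm_upto0 // => kf kg.
by rewrite (IH g) //; lia.
Qed.

Lemma tmE k : tm k = odd k (+) tm k./2.
Proof.
case: k => [|k] //; rewrite /tm [LHS]/=.
by congr (_ (+) _); apply: tm_upto_stable; lia.
Qed.

Lemma nth_subst_TM (w : seq bool) k : (k < (size w).*2)%N ->
  nth false (subst_word zeta_TM w) k = odd k (+) nth false w k./2.
Proof.
elim: w k => [|b w IH] k //=.
case: k => [|[|k]] /=; [by case: b|by case: b|].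
rewrite negbK => kw; rewrite -IH //.
by case: b.
Qed.

Lemma size_subst_TM (w : seq bool) :
  size (subst_word zeta_TM w) = (size w).*2.
Proof.
elim: w => // b w IH; rewrite /subst_word /= size_cat -/(subst_word _ w) IH.
by case: b.
Qed.

Lemma size_iter_TM m b : size (iter m (subst_word zeta_TM) [:: b]) = (2 ^ m)%N.
Proof. by elim: m => //= m IH; rewrite size_subst_TM IH expnS mul2n. Qed.

Lemma nth_iter_TM m b k : (k < 2 ^ m)%N ->
  nth false (iter m (subst_word zeta_TM) [:: b]) k = b (+) tm k.
Proof.
elim: m k => [|m IH] k.
  by rewrite expn0 ltnS leqn0 => /eqP-> /=; rewrite addbF.
rewrite expnS => km /=; rewrite nth_subst_TM ?size_iter_TM; last by lia.
by rewrite IH; [rewrite addbCA -tmE | lia].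
Qed.

(** The [m]-th iterate of the substitution at [b] is the prefix of length [2^m] of
[tm], flipped when [b] is set. *)
Lemma subshift_TM_window (x : int -> bool) n : subshift zeta_TM x ->
  exists p b, forall k, (k < n)%N -> x k%:Z = b (+) tm (p + k).
Proof.
move=> /(_ 0 n) [m [b /infixP[s [s' Es]]]].
exists (size s), b => k kn.
have sz : size (Defs.factor x 0 n) = n by rewrite size_map size_iota.
have lt : (size s + k < 2 ^ m)%N.
  by rewrite -(size_iter_TM m b) Es !size_cat sz ltn_add2l; lia.
rewrite -(@nth_iter_TM m) // Es nth_cat ifF; last by rewrite ltnNge leq_addr.
rewrite addKn nth_cat sz kn (nth_map 0%N) ?size_iota //.
by rewrite nth_iota // add0n add0r.
Qed.

(** * The complex exponential *)

Section ExponentialSums.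
Context {R : realType}.
Implicit Types (w r : R) (A : seq nat) (p q k l n N : nat).

Lemma F_iter (x : int -> bool) k :
  F (iter k (@left_shift bool) x) = (-1) ^+ x k%:Z :> R.
Proof.
have -> : iter k (@left_shift bool) x = fun i : int => x (i + k%:Z).
  elim: k => [|k IH] /=; first by apply/funext => i; rewrite addr0.
  by rewrite IH; apply/funext => i; rewrite /left_shift -addrA -intS.
have inC b : ((fun i => x (i + k%:Z)) \in cylinder b) = (x k%:Z == b).
  by apply/idP/eqP; rewrite inE /cylinder /= add0r.
by rewrite /F /= !indicE !inC; case: (x k%:Z); rewrite /= ?sub0r ?subr0.
Qed.

Lemma normc_norm (z : R[i]) : `|z| = (normc z)%:C. Proof. by []. Qed.

Lemma normc_ge0 (z : R[i]) : 0 <= normc z.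
Proof. by rewrite -ler0c -normc_norm. Qed.

Lemma normc_triangle (y z : R[i]) : normc (y + z) <= normc y + normc z.
Proof. exact: le_normcD. Qed.

Lemma normc_opp (z : R[i]) : normc (- z) = normc z.
Proof. exact: normcN. Qed.

Lemma normc_sub_le (y z : R[i]) : normc (y - z) <= normc y + normc z.
Proof. by rewrite (le_trans (normc_triangle _ _))// normc_opp. Qed.

Lemma normc_sum (I : Type) (s : seq I) (P : pred I) (f : I -> R[i]) :
  normc (\sum_(i <- s | P i) f i) <= \sum_(i <- s | P i) normc (f i).
Proof.
elim/big_rec2: _ => [|i b z _ h]; first by rewrite normc0.
by rewrite (le_trans (normc_triangle _ _))// lerD2l.
Qed.

Lemma eD r1 r2 : e (r1 + r2) = e r1 * e r2 :> R[i].
Proof.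
rewrite /e mulrDr cosD sinD; apply/eqP; rewrite eq_complex /= eqxx /=.
by rewrite addrC.
Qed.

Lemma e0 : e 0 = 1 :> R[i].
Proof. by rewrite /e mulr0 cos0 sin0. Qed.

Lemma normc_e r : normc (e r) = 1.
Proof. by rewrite /normc /e cos2Dsin2 sqrtr1. Qed.

Lemma normc_sign (b : bool) : normc ((-1) ^+ b : R[i]) = 1.
Proof. by case: b; rewrite ?expr1 ?expr0 ?normc_opp ?normc1. Qed.

Lemma normc_signe (b : bool) r : normc ((-1) ^+ b * e r) = 1.
Proof. by rewrite normcM normc_sign normc_e mulr1. Qed.

(** The length of the chord from 1 to [e w], see [normc_1Be]. *)
Definition chord w : R := 2 * `|sin (pi * w)|.

Lemma chord_ge0 w : 0 <= chord w. Proof. by rewrite /chord mulr_ge0. Qed.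

Lemma chord_le2 w : chord w <= 2.
Proof. by have := sin_max (pi * w); rewrite /chord; lra. Qed.

Lemma normc_1Be w : normc (1 - e w) = chord w.
Proof.
have -> : 1 - e w = (1 - cos (2 * pi * w)) +i* (- sin (2 * pi * w)).
  by apply/eqP; rewrite eq_complex /= sub0r !eqxx.
rewrite /normc.
have -> : 2 * pi * w = (pi * w) *+ 2 by rewrite mulr2n; ring.
rewrite sin_mulr2n cos_mulr2n; set s := sin _; set c := cos _.
have h : c ^+ 2 = 1 - s ^+ 2 by rewrite -(cos2Dsin2 (pi * w)) addrK.
have -> : (1 - (c ^+ 2 *+ 2 - 1)) ^+ 2 + (- ((c * s) *+ 2)) ^+ 2 = (2 * s) ^+ 2.
  have -> : (- ((c * s) *+ 2)) ^+ 2 = 4 * (c ^+ 2 * s ^+ 2) by ring.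
  rewrite h; ring.
by rewrite sqrtr_sqr normrM ger0_norm.
Qed.

End ExponentialSums.

(** * Exponential sums along the Thue-Morse sequence *)

(** The exponent of the sign of a product of factors; working with exclusive or
instead of signs makes repeated shifts cancel. *)
Definition tm_parity (A : seq nat) (k : nat) : bool :=
  \big[addb/false]_(a <- A) tm (k + a).

Definition halve (r : nat) (A : seq nat) : seq nat := [seq (r + a)./2 | a <- A].

(** This self-similarity is the only property of [tm] that the estimates use. *)
Lemma tm_parity_halve A r l : (r < 2)%N ->
  tm_parity A (l.*2 + r) = \big[addb/false]_(a <- A) odd (r + a) (+) tm_parity (halve r A) l.
Proof.
move=> r2; rewrite /tm_parity big_map -big_split; apply: eq_bigr => a _ /=.
rewrite tmE -addnA oddD odd_double addFb; congr (_ (+) tm _).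
lia.
Qed.

Lemma sign_big_addb (S : pzRingType) (I : Type) (s : seq I) (f : I -> bool) :
  \prod_(i <- s) (-1) ^+ f i = (-1) ^+ (\big[addb/false]_(i <- s) f i) :> S.
Proof. by symmetry; apply: (big_morph (fun b : bool => (-1) ^+ b)) => // *; exact: signr_addb. Qed.

Section TMSums.
Context {R : realType}.
Implicit Types (w C : R) (A : seq nat) (p q k l n r N : nat).

Definition tm_sum A p q w : R[i] :=
  \sum_(p <= k < q) (-1) ^+ tm_parity A k * e (k%:R * w).

Lemma normc_twisted_correlation N (a : seq nat) w (x : int -> bool) :
  subshift zeta_TM x -> exists p,
  normc (twisted_correlation N a w x) = normc (tm_sum (0%N :: a) p (p + N) w).
Proof.
move=> hx; pose M := (N + \max_(j <- a) j)%N.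
have [p [b hp]] := subshift_TM_window x M.+1 hx; exists p.
pose c := \big[addb/false]_(j <- 0%N :: a) b.
have -> : twisted_correlation N a w x =
    (-1) ^+ c * e (- (p%:R * w)) * tm_sum (0%N :: a) p (p + N) w; last first.
  by rewrite normcM normc_signe mul1r.
have -> : tm_sum (0%N :: a) p (p + N) w = \sum_(0 <= k < N)
    (-1) ^+ tm_parity (0%N :: a) (k + p) * e ((k + p)%:R * w).
  by rewrite /tm_sum -{1}(add0n p) big_addn addKn.
rewrite /twisted_correlation.
rewrite mulr_sumr big_nat [RHS]big_nat; apply: eq_bigr => k /= kN.
have -> : F (iter k (@left_shift bool) x) *
    \prod_(j <- a) F (iter (k + j) (@left_shift bool) x) =
    \prod_(j <- 0%N :: a) (-1) ^+ x (k + j)%N%:Z :> R.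
  rewrite big_cons addn0 F_iter; congr (_ * _).
  by apply: eq_bigr => j _; rewrite F_iter.
rewrite sign_big_addb.
have -> : \big[addb/false]_(j <- 0%N :: a) x (k + j)%N%:Z =
    c (+) tm_parity (0%N :: a) (k + p).
  rewrite /tm_parity -big_split big_seq [RHS]big_seq; apply: eq_bigr => j ja /=.
  rewrite hp; first by congr (_ (+) tm _); lia.
  rewrite /M ltnS leq_add //; first lia.
  move: ja; rewrite inE => /predU1P[->//|ja].
  by rewrite (big_rem j ja) /= leq_maxl.
rewrite signr_addb rmorphM !rmorph_sign /= natrD mulrDl eD.
have h : e (- (p%:R * w)) * e (p%:R * w) = 1 by rewrite -eD addNr e0.
by rewrite -[LHS]mulr1 -[X in _ * X = _]h; ring.
Qed.

Lemma normc_le_card (f : nat -> R[i]) p q :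
  (forall k, normc (f k) <= 1) -> normc (\sum_(p <= k < q) f k) <= (q - p)%:R.
Proof.
move=> f1; rewrite (le_trans (normc_sum _ _ _ _))//.
rewrite (le_trans (ler_sum _ (fun i _ => f1 i)))//.
by rewrite sumr_const_nat.
Qed.

Lemma sum_pairs (V : nmodType) (f : nat -> V) p q : (p <= q)%N ->
  \sum_(p.*2 <= k < q.*2) f k = \sum_(p <= l < q) (f l.*2 + f l.*2.+1).
Proof.
move=> pq; rewrite -(subnK pq); elim: (q - p)%N => [|n IH].
  by rewrite !big_geq.
by rewrite addSn doubleS !big_nat_recr /= ?IH ?addrA //; lia.
Qed.

(** At most one index is lost at each end of the window. *)
Lemma parity_split (f : nat -> R[i]) p q :
  (forall k, normc (f k) <= 1) ->
  normc (\sum_(p <= k < q) f k) <=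
    2 + normc (\sum_(uphalf p <= l < q./2) (f l.*2 + f l.*2.+1)).
Proof.
move=> f1; have [qp|pq] := leqP q p.
  by rewrite big_geq // normc0 addr_ge0 // normc_ge0.
have pE := odd_double_half p; have qE := odd_double_half q.
have uE := uphalf_half p.
have pq' : (uphalf p <= q./2)%N by move: pE qE uE; case: (odd p); case: (odd q) => /=; lia.
have pp' : (p <= (uphalf p).*2 <= p.+1)%N by move: pE uE; case: (odd p) => /=; lia.
rewrite -sum_pairs // (@big_cat_nat _ _ _ (uphalf p).*2) /=; [|lia|lia].
rewrite (@big_cat_nat _ _ _ (q./2).*2 (uphalf p).*2) /=; [|lia|lia].
have h1 := normc_le_card f p (uphalf p).*2 f1.
have h2 := normc_le_card f (q./2).*2 q f1.
have le1 m n : (m - n <= 1)%N -> (m - n)%:R <= 1 :> R by rewrite -(ler_nat R).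
have h1' : (((uphalf p).*2 - p)%:R : R) <= 1 by apply: le1; lia.
have h2' : ((q - (q./2).*2)%:R : R) <= 1 by apply: le1; lia.
have {}h1 := le_trans h1 h1'; have {}h2 := le_trans h2 h2'.
rewrite (le_trans (normc_triangle _ _))//.
have := normc_triangle (\sum_((uphalf p).*2 <= k < (q./2).*2) f k)
  (\sum_((q./2).*2 <= k < q) f k).
by lra.
Qed.

Lemma tm_term A l r w : (r < 2)%N ->
  (-1) ^+ tm_parity A (l.*2 + r) * e ((l.*2 + r)%:R * w) =
  (-1) ^+ (\big[addb/false]_(a <- A) odd (r + a)) * e (r%:R * w) *
  ((-1) ^+ tm_parity (halve r A) l * e (l%:R * (2 * w))) :> R[i].
Proof.
move=> r2; rewrite tm_parity_halve // signr_addb natrD mulrDl eD.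
have -> : l.*2%:R * w = l%:R * (2 * w) by rewrite -muln2 natrM mulrA.
by ring.
Qed.

Lemma tm_sum_step A p q w :
  normc (tm_sum A p q w) <= 2 +
    (normc (tm_sum (halve 0 A) (uphalf p) q./2 (2 * w)) +
     normc (tm_sum (halve 1 A) (uphalf p) q./2 (2 * w))).
Proof.
rewrite (le_trans (parity_split _ _ _ _)) ?lerD2l //.
  by move=> k; rewrite normc_signe.
rewrite big_split /= (le_trans (normc_triangle _ _))//.
under eq_bigr do rewrite -[_.*2]addn0 tm_term //.
under [X in _ + normc X]eq_bigr do rewrite -addn1 tm_term //.
by rewrite -!mulr_sumr !normcM !normc_sign !normc_e !mul1r.
Qed.

(** For a single factor the two halves are the same sum, with phases [1] and [- e w]. *)
Lemma tm_sum_single_step p q w :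
  normc (tm_sum [:: 0%N] p q w) <=
    2 + chord w * normc (tm_sum [:: 0%N] (uphalf p) q./2 (2 * w)).
Proof.
rewrite (le_trans (parity_split _ _ _ _)) ?lerD2l //.
  by move=> k; rewrite normc_signe.
rewrite (_ : \sum_(_ <= _ < _) _ =
  (1 - e w) * tm_sum [:: 0%N] (uphalf p) q./2 (2 * w)).
  by rewrite normcM normc_1Be.
rewrite mulr_sumr; apply: eq_bigr => l _.
have := tm_term [:: 0%N] l 0%N w isT; rewrite addn0 => ->.
have := tm_term [:: 0%N] l 1%N w isT; rewrite addn1 => ->.
rewrite /halve /= !big_seq1 /= expr0 expr1 mul0r e0 !mul1r; ring.
Qed.

(** Even indices contribute a constant product, odd ones reproduce the sum. *)
Lemma tm_sum_pair_step p q w :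
  normc (tm_sum [:: 0; 1]%N p q w) <=
    2 + (normc (tm_sum [::] (uphalf p) q./2 (2 * w)) +
     normc (tm_sum [:: 0; 1]%N (uphalf p) q./2 (2 * w))).
Proof.
have := tm_sum_step [:: 0; 1]%N p q w.
rewrite /halve /= (_ : tm_sum [:: 0; 0]%N _ _ _ = tm_sum [::] (uphalf p) q./2 (2 * w)) //.
apply: eq_bigr => k _; congr (_ ^+ _ * _).
by rewrite /tm_parity !big_cons big_nil addbF addbb.
Qed.

(** A telescoping sum after multiplication by [1 - e w]. *)
Lemma tm_sum_nil_bound p q w : chord w * normc (tm_sum [::] p q w) <= 2.
Proof.
have [qp|/ltnW pq] := leqP q p.
  by rewrite /tm_sum big_geq // normc0 mulr0.
rewrite -normc_1Be -normcM.
have -> : (1 - e w) * tm_sum [::] p q w = e (p%:R * w) - e (q%:R * w).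
  rewrite -(subnK pq); elim: (q - p)%N => [|n IH].
    by rewrite add0n /tm_sum big_geq // mulr0 subrr.
  rewrite /tm_sum addSn big_nat_recr ?leq_addl //= mulrDr IH.
  have -> : e ((n + p).+1%:R * w) = e ((n + p)%:R * w) * e w.
    by rewrite -addn1 natrD mulrDl mul1r eD.
  rewrite /tm_parity big_nil expr0 mul1r.
  by ring.
by rewrite (le_trans (normc_sub_le _ _)) // !normc_e.
Qed.

Lemma tm_sum_singleS p q w :
  normc (tm_sum [:: 1%N] p q w) = normc (tm_sum [:: 0%N] p.+1 q.+1 w).
Proof.
have -> : tm_sum [:: 0%N] p.+1 q.+1 w = e w * tm_sum [:: 1%N] p q w.
  rewrite /tm_sum big_add1 mulr_sumr; apply: eq_bigr => k _ /=.
  by rewrite /tm_parity !big_seq1 addn0 addn1 -addn1 natrD mulrDl mul1r eD; ring.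
by rewrite normcM normc_e mul1r.
Qed.

End TMSums.

(** * Reduction to the shifts 0 and 1 *)

Lemma tm_parity_small (A : seq nat) k : all (leq^~ 1%N) A ->
  tm_parity A k = odd (count_mem 0%N A) && tm k (+) odd (count_mem 1%N A) && tm k.+1.
Proof.
rewrite /tm_parity; elim: A => [|a A IH] /=; first by rewrite big_nil.
move=> /andP[a1 /IH h]; rewrite big_cons h.
move: (count_mem _ _) (count_mem _ _) => c1 c2.
case: a a1 => [|[|a]] //= _; rewrite ?addn0 ?addn1 ?add0n ?add1n /=;
  by case: (tm k); case: (tm k.+1); case: (odd c1); case: (odd c2).
Qed.

Lemma tm_parity_small_cases (A : seq nat) : all (leq^~ 1%N) A -> exists A',
  [/\ A' \in [:: [::]; [:: 0%N]; [:: 1%N]; [:: 0%N; 1%N]],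
      odd (size A') = odd (size A) & tm_parity A =1 tm_parity A'].
Proof.
move=> A1.
have sz : size A = (count_mem 0%N A + count_mem 1%N A)%N.
  elim: A A1 => //= a A IH /andP[a1 /IH ->].
  by case: a a1 => [|[|]] //= _; lia.
have tE := fun k => tm_parity_small A k A1.
rewrite sz; move: tE; rewrite oddD.
case: (odd (count_mem 0%N A)); case: (odd (count_mem 1%N A)) => /= tE.
- by exists [:: 0%N; 1%N]; split=> // k; rewrite tE tm_parity_small.
- by exists [:: 0%N]; split=> // k; rewrite tE tm_parity_small.
- by exists [:: 1%N]; split=> // k; rewrite tE tm_parity_small.
- by exists [::]; split=> // k; rewrite tE tm_parity_small.
Qed.

Section Reduction.
Context {R : realType}.
Implicit Types (w C : R) (A : seq nat) (p q k l n r N : nat) (rho : nat -> R).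

Lemma eq_tm_sum A A' p q w : tm_parity A =1 tm_parity A' -> tm_sum A p q w = tm_sum A' p q w.
Proof. by move=> AA'; apply: eq_bigr => k _; rewrite AA'. Qed.

(** The constant may depend on [A] and [w]; the rate bounds all windows of length
at most [N], so that windows can shrink while the rate stays the same. *)
Definition tm_bounded rho A w := exists2 C, 0 <= C & forall N p q,
  (16 <= N)%N -> (q - p <= N)%N -> normc (tm_sum A p q w) <= C * rho N.

Lemma halve_shrinks M A r : (r < 2)%N -> all (leq^~ M.+2) A ->
  all (leq^~ M.+1) (halve r A).
Proof.
move=> r2 /allP AM; apply/allP => _ /mapP[a /AM /= aM ->].
lia.
Qed.

Lemma half_length p q : (q./2 - uphalf p <= (q - p)./2)%N.
Proof. rewrite uphalf_half; have := odd_double_half p; case: (odd p) => /=; lia. Qed.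

(** [G] stands for a set of good frequencies stable under doubling: the
induction on the largest shift replaces [w] by [2w]. *)
Lemma tm_bounded_reduction rho (G : R -> Prop) b :
  (forall N, (16 <= N)%N -> 1 <= rho N) ->
  (forall w, G w -> G (2 * w)) ->
  (forall A w, all (leq^~ 1%N) A -> odd (size A) = b -> G w ->
     tm_bounded rho A w) ->
  forall A w, odd (size A) = b -> G w -> tm_bounded rho A w.
Proof.
move=> rho1 G2 small A w Ab Gw.
have [M AM] : exists M, all (leq^~ M.+1) A.
  exists (\max_(j <- A) j)%N; apply/allP => j jA.
  by rewrite (big_rem j jA) /= leqW// leq_maxl.
elim: M A w AM Ab Gw => [|M IH] A w AM Ab Gw; first exact: small.
have Gw2 := G2 _ Gw.
have [] := IH (halve 0 A) (2 * w) (halve_shrinks M A 0 isT AM) _ Gw2.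
  by rewrite size_map.
move=> C0 C00 H0.
have [] := IH (halve 1 A) (2 * w) (halve_shrinks M A 1 isT AM) _ Gw2.
  by rewrite size_map.
move=> C1 C10 H1.
exists (2 + (C0 + C1)); first by rewrite !addr_ge0.
move=> N p q N16 qpN.
have qpN' : (q./2 - uphalf p <= N)%N.
  by rewrite (leq_trans (half_length p q))// (leq_trans _ qpN)//; lia.
rewrite (le_trans (tm_sum_step _ _ _ _))//.
have := H0 _ _ _ N16 qpN'; have := H1 _ _ _ N16 qpN'; have := rho1 _ N16.
by lra.
Qed.

Lemma tm_bounded_odd rho (G : R -> Prop) :
  (forall N, (16 <= N)%N -> 1 <= rho N) ->
  (forall w, G w -> G (2 * w)) ->
  (forall w, G w -> tm_bounded rho [:: 0%N] w) ->
  forall A w, odd (size A) -> G w -> tm_bounded rho A w.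
Proof.
move=> rho1 G2 base A w oA; apply: (tm_bounded_reduction rho G true) => // {w oA}A w A1 oA Gw.
have [A' [A's oA' AA']] := tm_parity_small_cases A A1.
have [C C0 H] := base w Gw; exists C => // N p q N16 qpN.
rewrite (eq_tm_sum A A') //.
move: A's oA'; rewrite !inE => /or4P[] /eqP ->; rewrite ?oA //= => _; first exact: H.
by rewrite tm_sum_singleS H // subSS.
Qed.

Lemma tm_bounded_even rho (G : R -> Prop) :
  (forall N, (16 <= N)%N -> 1 <= rho N) ->
  (forall w, G w -> G (2 * w)) ->
  (forall w, G w -> tm_bounded rho [::] w) ->
  (forall w, G w -> tm_bounded rho [:: 0; 1]%N w) ->
  forall A w, ~~ odd (size A) -> G w -> tm_bounded rho A w.
Proof.
move=> rho1 G2 base0 base2 A w /negbTE oA.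
apply: (tm_bounded_reduction rho G false) => // {w oA}A w A1 oA Gw.
have [A' [A's oA' AA']] := tm_parity_small_cases A A1.
have [C0 C00 H0] := base0 w Gw; have [C2 C20 H2] := base2 w Gw.
exists (C0 + C2) => [|N p q N16 qpN]; first exact: addr_ge0.
have rho0 : 0 <= rho N by rewrite (le_trans ler01)// rho1.
rewrite (eq_tm_sum A A') // mulrDl.
move: A's oA'; rewrite !inE => /or4P[] /eqP ->; rewrite ?oA //= => _.
  by rewrite ler_wpDr ?mulr_ge0// H0.
by rewrite ler_wpDl ?mulr_ge0// H2.
Qed.

(** The exponential of the [n]-th Birkhoff sum of [ln chord] for the doubling
map. *)
Definition chord_prod n w : R := \prod_(i < n) chord (2 ^+ i * w).

Lemma chord_prodS n w : chord_prod n.+1 w = chord w * chord_prod n (2 * w).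
Proof.
rewrite /chord_prod big_ord_recl expr0 mul1r; congr (_ * _).
by apply: eq_bigr => i _; rewrite /= exprSr mulrA.
Qed.

Lemma chord_prod_ge0 n w : 0 <= chord_prod n w.
Proof. by apply: prodr_ge0 => i _; exact: chord_ge0. Qed.

Lemma chord_prod_le n w : chord_prod n w <= 2 ^+ n.
Proof.
rewrite /chord_prod -[X in 2 ^+ X]card_ord -prodr_const.
by apply: ler_prod => i _; rewrite chord_ge0 chord_le2.
Qed.

Lemma chord_prodD m n w : chord_prod (m + n) w = chord_prod m w * chord_prod n (2 ^+ m * w).
Proof.
elim: m w => [|m IH] w; first by rewrite /chord_prod big_ord0 expr0 !mul1r.
by rewrite addSn !chord_prodS IH mulrA exprSr mulrA.
Qed.

Lemma length_step n p q : (q - p < 2 ^ n.+1)%N -> (q./2 - uphalf p < 2 ^ n)%N.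
Proof. by rewrite expnS => h; have := half_length p q; lia. Qed.

Lemma tm_sum_single_bound n p q w : (q - p < 2 ^ n)%N ->
  normc (tm_sum [:: 0%N] p q w) <= 2 * \sum_(j < n) chord_prod j w.
Proof.
elim: n p q w => [|n IH] p q w.
  rewrite expn0 ltnS leqn0 => /eqP qp.
  by rewrite /tm_sum big_geq ?normc0 ?big_ord0 ?mulr0 //; lia.
move=> /length_step /IH h.
have step := tm_sum_single_step p q w.
have {}h := ler_wpM2l (chord_ge0 w) (h (2 * w)).
have d0 : chord_prod 0 w = 1 by rewrite /chord_prod big_ord0.
have dS : \sum_(j < n) chord_prod j.+1 w = chord w * \sum_(j < n) chord_prod j (2 * w).
  by rewrite mulr_sumr; apply: eq_bigr => j _; rewrite chord_prodS.
rewrite big_ord_recl d0 /= /bump /=; under eq_bigr do rewrite add1n.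
by rewrite dS; lra.
Qed.

Lemma tm_sum_pair_bound n p q w : (forall j, 0 < chord (2 ^+ j * w)) ->
  (q - p < 2 ^ n)%N ->
  normc (tm_sum [:: 0; 1]%N p q w) <= \sum_(j < n) (2 + 2 / chord (2 ^+ j.+1 * w)).
Proof.
elim: n p q w => [|n IH] p q w dpos.
  rewrite expn0 ltnS leqn0 => /eqP qp.
  by rewrite /tm_sum big_geq ?normc0 ?big_ord0 //; lia.
have dpos2 j : 0 < chord (2 ^+ j * (2 * w)) by rewrite mulrA -exprSr.
move=> /length_step /(IH _ _ (2 * w) dpos2) h.
have step := tm_sum_pair_step p q w.
have d2 : 0 < chord (2 * w) by have := dpos 1%N; rewrite expr1.
have h0 : normc (tm_sum [::] (uphalf p) q./2 (2 * w)) <= 2 / chord (2 * w).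
  by rewrite ler_pdivlMr // mulrC tm_sum_nil_bound.
have dS : \sum_(j < n) (2 + 2 / chord (2 ^+ j.+2 * w)) =
    \sum_(j < n) (2 + 2 / chord (2 ^+ j.+1 * (2 * w))).
  by apply: eq_bigr => j _; rewrite [in LHS]exprSr mulrA.
rewrite big_ord_recl expr1 /= /bump /=; under eq_bigr do rewrite add1n.
by rewrite dS; lra.
Qed.

End Reduction.

(** * Means over the unit interval and the doubling map *)

Section UnitInterval.
Context {R : realType}.
Implicit Types (f g : R -> R).
Local Notation mu := (@lebesgue_measure R).

Definition mean f : R := \int[mu]_(x in `[0, 1]) f x.

Lemma mean_integrable f : continuous f -> mu.-integrable `[0, 1] (EFin \o f).
Proof.
move=> cf; apply: continuous_compact_integrable; first exact: segment_compact.
exact: continuous_subspaceT.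
Qed.

Lemma le_mean f g : continuous f -> continuous g ->
  (forall x, f x <= g x) -> mean f <= mean g.
Proof. by move=> cf cg fg; apply: le_Rintegral => //; exact: mean_integrable. Qed.

Lemma eq_mean f g : f =1 g -> mean f = mean g.
Proof. by move=> fg; apply: eq_Rintegral => x _; exact: fg. Qed.

Lemma meanD f g : continuous f -> continuous g ->
  mean (fun x => f x + g x) = mean f + mean g.
Proof. by move=> cf cg; apply: RintegralD => //; exact: mean_integrable. Qed.

Lemma meanZ (c : R) f : continuous f -> mean (fun x => c * f x) = c * mean f.
Proof. by move=> cf; apply: RintegralZl => //; exact: mean_integrable. Qed.

Lemma mean_cst (c : R) : mean (fun=> c) = c.
Proof.
rewrite /mean Rintegral_cst //.
have := @lebesgue_measure_itv R `[0, 1]; rewrite /= lte_fin ltr01 oppr0 adde0.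
by move=> /(congr1 fine) /= h; rewrite -[RHS]mulr1; congr (_ * _).
Qed.

Lemma continuous_sum (I : Type) (s : seq I) (f : I -> R -> R) :
  (forall i, continuous (f i)) -> continuous (fun x => \sum_(i <- s) f i x).
Proof.
move=> cf; elim: s => [|i s IH] x.
  under eq_fun do rewrite big_nil; exact: cst_continuous.
under eq_fun do rewrite big_cons.
by apply: cvgD; [exact: cf|exact: IH].
Qed.

Lemma mean_sum (I : Type) (s : seq I) (f : I -> R -> R) :
  (forall i, continuous (f i)) ->
  mean (fun x => \sum_(i <- s) f i x) = \sum_(i <- s) mean (f i).
Proof.
move=> cf; elim: s => [|i s IH].
  by rewrite big_nil -[RHS](mean_cst 0); apply: eq_mean => x; rewrite big_nil.
rewrite big_cons -IH -meanD //; last exact: continuous_sum.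
by apply: eq_mean => x; rewrite big_cons.
Qed.

Lemma continuous_affine (c m : R) : continuous (fun x : R => m * (x + c)).
Proof.
move=> x; apply: cvgM; first exact: cvg_cst.
by apply: cvgD; [exact: cvg_id|exact: cvg_cst].
Qed.

Lemma continuous_comp_affine f (c m : R) : continuous f ->
  continuous (fun x : R => f (m * (x + c))).
Proof.
move=> cf x; apply: (@continuous_comp _ _ _ (fun x => m * (x + c)) f).
  exact: continuous_affine.
exact: cf.
Qed.

Lemma integral_half f (c : R) : continuous f ->
  \int[mu]_(x in `[2^-1 * c, 2^-1 * (1 + c)]) f x =
  mean (fun x => 2^-1 * f (2^-1 * (x + c))).
Proof.
move=> cf; pose h (x : R) := 2^-1 * (x + c).
have ch : continuous h by exact: continuous_affine.
have dh x : derivable h x 1 by [].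
have h' : derive1 h = cst 2^-1.
  apply/funext => x; rewrite derive1E deriveM // deriveD // derive_cst derive_id derive_cst.
  by rewrite scaler0 addr0 addr0 /GRing.scale /= mulr1.
have := @integration_by_substitution_increasing R h f 0 1 ler01.
have h0 : h 0 = 2^-1 * c by rewrite /h add0r.
rewrite h' h0 -/(h 1) => H; rewrite /Rintegral H; first last.
- exact: continuous_subspaceT.
- split => //.
  + by apply: cvg_at_right_filter; exact: ch.
  + by apply: cvg_at_left_filter; exact: ch.
- exact: is_cvg_cst.
- exact: is_cvg_cst.
- by move=> x _; exact: cst_continuous.
- by move=> x y _ _ xy; rewrite /h ltr_pM2l ?invr_gt0// ltrD2r.
by congr fine; apply: eq_integral => x _; rewrite /= fctE /= mulrC.
Qed.

(** Invariance of Lebesgue measure under doubling, stated through the transfer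
operator, the average over the two preimages. *)
Lemma mean_transfer f : continuous f ->
  mean f = mean (fun x => 2^-1 * (f (2^-1 * x) + f (2^-1 * (x + 1)))).
Proof.
move=> cf.
have := @Rintegral_itvB R f (BLeft 0) (BRight 1) 2^-1 (mean_integrable f cf).
rewrite !bnd_simp invr_ge0 ler0n invf_le1 // ler1n => /(_ isT isT).
have h0 := integral_half f 0 cf; have h1 := integral_half f 1 cf.
rewrite mulr0 addr0 mulr1 in h0.
rewrite mulr1 (_ : 2^-1 * (1 + 1) = 1) in h1; last by rewrite -[1+1]/2 mulVf.
rewrite h0 Rintegral_itv_obnd_cbnd; last first.
  apply: integrableS (mean_integrable f cf) => //; apply: subset_itvr.
  by rewrite bnd_simp invr_ge0.
rewrite h1 -/(mean f) => /eqP; rewrite subr_eq => /eqP ->.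
rewrite -meanD.
- by apply: eq_mean => x; rewrite addr0; ring.
- by move=> x; apply: cvgM; [exact: cvg_cst|exact: continuous_comp_affine].
- by move=> x; apply: cvgM; [exact: cvg_cst|exact: continuous_comp_affine].
Qed.

Lemma mean_EFin f : continuous f ->
  (\int[mu]_(x in `[0%R, 1%R]) (f x)%:E = (mean f)%:E)%E.
Proof.
move=> cf; rewrite /mean /Rintegral fineK //.
by apply: integrable_fin_num => //; exact: mean_integrable.
Qed.

(** The sum of the [g k] has a finite integral, hence is finite almost
everywhere, and it dominates each term.  This replaces Markov's inequality and the
Borel-Cantelli lemma. *)
Lemma ae_bounded (g : nat -> R -> R) (M : R) :
  (forall k, continuous (g k)) -> (forall k x, 0 <= g k x) ->
  (forall n, \sum_(k < n) mean (g k) <= M) ->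
  {ae mu, forall w, `[0, 1]%classic w -> exists C, forall k, g k w <= C}.
Proof.
move=> cg g0 gM.
pose S (x : R) := (\sum_(k <oo) (g k x)%:E)%E.
have mg (k : nat) := measurable_int mu (mean_integrable (g k) (cg k)).
have S0 x : (0 <= S x)%E by apply: nneseries_ge0 => n _ _; rewrite lee_fin.
have intS : (\int[mu]_(x in `[0%R, 1%R]) S x <= M%:E)%E.
  rewrite /S integral_nneseries //; last by move=> n x _; rewrite lee_fin.
  apply: lime_le.
    by apply: is_cvg_nneseries => n _ _; apply: integral_ge0 => x _; rewrite lee_fin.
  apply: nearW => n /=; rewrite big_mkord.
  under eq_bigr do rewrite mean_EFin //.
  by rewrite sumEFin lee_fin.
have iS : mu.-integrable `[0%R, 1%R] S.
  apply/integrableP; split.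
    apply: ge0_emeasurable_sum => [k x _ _|k _]; [by rewrite lee_fin|exact: mg].
  under eq_integral do rewrite gee0_abs //.
  by rewrite (le_lt_trans intS)// ltry.
apply: filterS (integrable_ae _ iS) => // x Sx w01; exists (fine (S x)) => k.
rewrite -lee_fin fineK ?Sx //.
have := @nneseries_lim_ge R (fun k => (g k x)%:E) xpredT 0 k.+1.
move=> /(_ (fun n _ _ => _)) h; rewrite (le_trans _ (h _)) //; last first.
  by move=> n; rewrite lee_fin.
rewrite big_mkord big_ord_recr /= leeDr //.
by apply: sume_ge0 => i _; rewrite lee_fin.
Qed.

End UnitInterval.

(** * A superharmonic weight for the transfer operator *)

Section Moments.
Context {R : realType}.
Implicit Types (f g : R -> R) (l w x a b : R).

(** At [a = b = 1] both sides agree to first order, and for [a <= b = 1] the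
difference is at least [(1 - a)^2], which absorbs the cross terms in [1 - a] and
[b - 1].  The exponent 4 matters: with the weight [2 + a^3] in the
place of [3 + a^4] the difference at [b = 1] is only of order [(1 - a)^3], and the error is no longer
quadratic in [l]. *)
Lemma transfer_poly_ineq l a b : 0 <= a <= b -> 1 <= b <= 1 + l -> l <= 1 ->
  2^-1 * ((3 + a ^+ 4) * a + (3 + b ^+ 4) * b) <=
  (1 + 26 * l ^+ 2) * (3 + (a * b) ^+ 4).
Proof.
move=> /andP[a0 ab] /andP[b1 bl] l1.
(* [t] and [1 - a] are the distances to the point of contact. *)
set t := b - 1.
have t0 : 0 <= t by rewrite /t; lra.
have tl : t <= l by rewrite /t; lra.
have t1 : t <= 1 by lra.
have l20 : t ^+ 2 <= l ^+ 2 by rewrite lerXn2r ?nnegrE //; lra.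
have ab40 : 0 <= (a * b) ^+ 4 by rewrite exprn_ge0 // mulr_ge0 //; lra.
have q_bound : 4 <= b ^+ 3 + b ^+ 2 + b + 1.
  have : 1 <= b ^+ 2 by rewrite exprn_ege1.
  have : 1 <= b ^+ 3 by rewrite exprn_ege1.
  by lra.
have r_bound : b ^+ 4 + b ^+ 3 + b ^+ 2 + b + 1 <= 5 + 26 * t.
  have -> : b = 1 + t by rewrite /t; ring.
  have tn n : t ^+ n.+1 <= t by rewrite exprS ler_piMr // exprn_ile1.
  have := tn 1%N; have := tn 2%N; have := tn 3%N.
  have -> : (1 + t) ^+ 4 + (1 + t) ^+ 3 + (1 + t) ^+ 2 + (1 + t) + 1 =
    5 + 10 * t + 10 * t ^+ 2 + 5 * t ^+ 3 + t ^+ 4 by ring.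
  by lra.
pose K := a ^+ 4 * (b ^+ 3 + b ^+ 2 + b + 1) -
  2^-1 * (3 + (b ^+ 4 + b ^+ 3 + b ^+ 2 + b + 1)).
have key : 3 + (a * b) ^+ 4 - 2^-1 * ((3 + a ^+ 4) * a + (3 + b ^+ 4) * b) =
    (1 - a) ^+ 2 * (1 + 2^-1 * a - 2^-1 * a ^+ 3) + t * K.
  by rewrite /K /t; field.
have a40 : 0 <= a ^+ 4 by rewrite exprn_ge0.
have K1 : 4 * a ^+ 4 - 4 - 13 * t <= K.
  by have := ler_wpM2l a40 q_bound; rewrite /K; lra.
suff : - 78 * t ^+ 2 <= (1 - a) ^+ 2 * (1 + 2^-1 * a - 2^-1 * a ^+ 3) + t * K.
  have := ler_wpM2l (sqr_ge0 l) (_ : 3 <= 3 + (a * b) ^+ 4).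
  rewrite lerDl => /(_ ab40); rewrite -key; lra.
have tK := ler_wpM2l t0 K1.
have [a1|a1] := lerP a 1.
(* Here [1 + a/2 - a^3/2 >= 1], and the negative terms are absorbed by the
   square of [1 - a - 8t]. *)
- have a3 : a ^+ 3 <= a by rewrite exprS ler_piMr // exprn_ile1.
  have bern : 1 - 4 * (1 - a) <= a ^+ 4.
    have -> : a ^+ 4 = 1 - 4 * (1 - a) + (1 - a) ^+ 2 * (a ^+ 2 + 2 * a + 3) by ring.
    by rewrite lerDl mulr_ge0 ?sqr_ge0 // !addr_ge0 ?sqr_ge0 ?mulr_ge0.
  have h1 : (1 - a) ^+ 2 <= (1 - a) ^+ 2 * (1 + 2^-1 * a - 2^-1 * a ^+ 3).
    by rewrite ler_peMr ?sqr_ge0 //; lra.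
  have h2 : t * (- 16 * (1 - a) - 13 * t) <= t * (4 * a ^+ 4 - 4 - 13 * t).
    by apply: ler_wpM2l => //; lra.
  have : 0 <= (1 - a - 8 * t) ^+ 2 by rewrite sqr_ge0.
  have -> : (1 - a - 8 * t) ^+ 2 = (1 - a) ^+ 2 - 16 * (t * (1 - a)) + 64 * t ^+ 2.
    by ring.
  have : t * (- 16 * (1 - a) - 13 * t) = - 16 * (t * (1 - a)) - 13 * t ^+ 2 by ring.
  have := sqr_ge0 t.
  by lra.
(* Here [a] lies between 1 and [b], so that [|1 - a| <= t]. *)
- have a3 : a ^+ 3 <= 8.
    have a2 : a <= 2 by lra.
    by rewrite (_ : 8 = 2 ^+ 3); [rewrite lerXn2r ?nnegrE //|ring].
  have a4 : 1 <= a ^+ 4 by rewrite exprn_ege1 // ltW.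
  have h0 : (1 - a) ^+ 2 <= t ^+ 2.
    by rewrite -sqrrN opprB lerXn2r ?nnegrE /t; lra.
  have h1 : - 3 * t ^+ 2 <= (1 - a) ^+ 2 * (1 + 2^-1 * a - 2^-1 * a ^+ 3).
    have : - 3 <= 1 + 2^-1 * a - 2^-1 * a ^+ 3 by lra.
    by move=> /(ler_wpM2l (sqr_ge0 (1 - a))); lra.
  have h2 : t * (- 13 * t) <= t * (4 * a ^+ 4 - 4 - 13 * t).
    by apply: ler_wpM2l => //; lra.
  have : t * (- 13 * t) = - 13 * t ^+ 2 by ring.
  have := sqr_ge0 t.
  by lra.
Qed.

(** The chord of the convex function [2^l] over [0, 1]. *)
Lemma pow2_le1D l : 0 <= l -> l <= 1 -> 2 `^ l <= 1 + l.
Proof.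
move=> l0 l1; have := @convex_expR R (Itv01 l0 l1) (ln 2) 0.
rewrite !convRE /= expR0 lnK ?posrE // mulr0 addr0 mulr1.
by rewrite /powR gt_eqF // => /le_trans; apply; rewrite /unstable.onem; lra.
Qed.

Definition weight l x := 3 + (chord x `^ l) ^+ 4.

Lemma larger_half_chord (s c : R) : 0 <= s -> s <= c -> s ^+ 2 + c ^+ 2 = 4 -> 1 <= c <= 2.
Proof.
move=> s0 sc h; have c0 : 0 <= c by lra.
by apply/andP; split; nra.
Qed.

(** Here [s] and [c] are the values of [chord] at the two preimages of a point, and
[s * c] is its value at the point, see [chord_half]. *)
Lemma transfer_ineq l (s c : R) : 0 <= l <= 1 -> 0 <= s -> 0 <= c ->
  s ^+ 2 + c ^+ 2 = 4 ->
  2^-1 * ((3 + (s `^ l) ^+ 4) * s `^ l + (3 + (c `^ l) ^+ 4) * c `^ l) <=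
  (1 + 26 * l ^+ 2) * (3 + ((s * c) `^ l) ^+ 4).
Proof.
move=> /andP[l0 l1] s0 c0; rewrite powRM //.
wlog sc : s c s0 c0 / s <= c.
  move=> H sc4; have [/H|/ltW/H] := leP s c; first exact.
  by rewrite (addrC (_ * c `^ l)) (mulrC (c `^ l)); apply => //; rewrite addrC.
move=> sc4; have /andP[c1 c2] := larger_half_chord s c s0 sc sc4.
apply: transfer_poly_ineq => //.
  by rewrite powR_ge0 ge0_ler_powR.
rewrite (le_trans _ (pow2_le1D l l0 l1)) ?andbT; last by rewrite ge0_ler_powR ?nnegrE.
by rewrite -[leLHS](powRr0 c) ler_powR.
Qed.

(** The duplication formula of the sine: the preimages see [2|sin y|] and
[2|cos y|] with [y = pi x / 2]. *)
Lemma chord_half x :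
  [/\ chord (2^-1 * x) ^+ 2 + chord (2^-1 * (x + 1)) ^+ 2 = 4 &
      chord (2^-1 * x) * chord (2^-1 * (x + 1)) = chord x].
Proof.
rewrite /chord.
have -> : pi * (2^-1 * (x + 1)) = pi * (2^-1 * x) + pi / 2 by field.
have -> : pi * x = (pi * (2^-1 * x)) *+ 2 by rewrite -mulr_natr; field.
rewrite sinDpihalf sin_mulr2n; set y := pi * _.
split.
- rewrite !exprMn !real_normK ?num_real // -mulrDr addrC cos2Dsin2; ring.
- by rewrite (_ : (cos y * sin y) *+ 2 = 2 * (cos y * sin y)) ?normrM ?normr_nat; ring.
Qed.

Lemma chord_periodic x n : chord (x + n%:R) = chord x.
Proof.
elim: n => [|n IH]; first by rewrite addr0.
rewrite -addn1 natrD addrA -[RHS]IH /chord; set y := x + _.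
by rewrite mulrDr mulr1 sinDpi normrN.
Qed.

Lemma chord_prod_periodic n x : chord_prod n (x + 1) = chord_prod n x.
Proof.
apply: eq_bigr => i _.
by rewrite mulrDr mulr1 -natrX chord_periodic.
Qed.

Lemma continuous_chord : continuous (@chord R).
Proof.
move=> x; apply: cvgM; first exact: cvg_cst.
apply: (@continuous_comp _ _ _ (fun y => sin (pi * y)) (fun y => `|y|)); last exact: norm_continuous.
apply: (@continuous_comp _ _ _ (fun y => pi * y) sin); last exact: continuous_sin.
by apply: cvgM; [exact: cvg_cst|exact: cvg_id].
Qed.

Lemma continuous_scale f (m : R) : continuous f -> continuous (fun x => f (m * x)).
Proof.
move=> cf x; apply: (@continuous_comp _ _ _ (fun x => m * x) f); last exact: cf.
by apply: cvgM; [exact: cvg_cst|exact: cvg_id].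
Qed.

Lemma continuous_chord_prod n : continuous (@chord_prod R n).
Proof.
elim: n => [|n IH].
  rewrite (_ : chord_prod 0 = cst 1); first exact: cst_continuous.
  by apply/funext => x; rewrite /chord_prod big_ord0.
rewrite (_ : chord_prod n.+1 = fun x => chord x * chord_prod n (2 * x)).
  move=> x; apply: cvgM; first exact: continuous_chord.
  by apply: continuous_scale.
by apply/funext => x; rewrite chord_prodS.
Qed.

Lemma continuous_powR f l : 0 <= l -> continuous f -> (forall x, 0 <= f x) ->
  continuous (fun x => f x `^ l).
Proof.
rewrite le_eqVlt => /predU1P[<-|l0] cf f0.
  under eq_fun do rewrite powRr0; exact: cst_continuous.
move=> x; have := f0 x; rewrite le_eqVlt => /predU1P[fx0|fx0].
  rewrite /continuous_at -fx0 powR0 ?gt_eqF //; apply/cvgr0Pnorm_le => eps eps0.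
  have e0 : 0 < eps `^ l^-1 by rewrite powR_gt0.
  have := cf x; rewrite /continuous_at -fx0 => /cvgr0Pnorm_le /(_ _ e0).
  apply: filterS => y; rewrite !ger0_norm ?powR_ge0 // => fy.
  rewrite (le_trans (ge0_ler_powR (ltW l0) _ _ fy)) ?nnegrE ?powR_ge0 //.
  by rewrite -powRrM mulVf ?gt_eqF // powRr1 // ltW.
apply: (@continuous_comp _ _ _ f (fun y => y `^ l)); first exact: cf.
apply/differentiable_continuous/derivable1_diffP; apply: derivable_powR.
by rewrite in_itv /= fx0.
Qed.

End Moments.

(** * Sub-Gaussian moments of the chord products *)

Section Means.
Context {R : realType}.
Implicit Types (f g h : R -> R) (l w x a b : R).

Lemma mean_double h m : continuous h -> (forall x, h (x + 1) = h x) ->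
  mean (fun x => h (2 ^+ m * x)) = mean h.
Proof.
move=> ch h1; elim: m => [|m IH].
  by apply: eq_mean => x; rewrite expr0 mul1r.
rewrite mean_transfer; last exact: continuous_scale.
rewrite -IH; apply: eq_mean => x.
have hn y n : h (y + n%:R) = h y.
  by elim: n y => [|n IHn] y; rewrite ?addr0 // -addn1 natrD addrA h1 IHn.
have -> : 2 ^+ m.+1 * (2^-1 * x) = 2 ^+ m * x by rewrite exprSr; field.
have -> : 2 ^+ m.+1 * (2^-1 * (x + 1)) = 2 ^+ m * x + (2 ^ m)%:R.
  by rewrite natrX exprSr; field.
by rewrite hn; field.
Qed.

Lemma continuous_weight l : 0 <= l -> continuous (@weight R l).
Proof.
move=> l0 x; apply: cvgD; first exact: cvg_cst.
under eq_fun do rewrite exprS exprS expr2.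
have c : continuous (fun x : R => chord x `^ l).
  by apply: continuous_powR => //; [exact: continuous_chord|exact: chord_ge0].
by do 3!(apply: cvgM; first exact: c); exact: c.
Qed.

Lemma weight_ge3 l x : 3 <= weight l x.
Proof. by rewrite lerDl exprn_ge0 // powR_ge0. Qed.

Lemma weight_le l x : 0 <= l <= 1 -> weight l x <= 19.
Proof.
move=> /andP[l0 l1].
have h : chord x `^ l <= 2.
  rewrite (@le_trans _ _ (2 `^ l)) //; first by rewrite ge0_ler_powR ?nnegrE ?chord_ge0 ?chord_le2.
  by rewrite (le_trans (pow2_le1D l l0 l1)) //; lra.
have : (chord x `^ l) ^+ 4 <= 2 ^+ 4 by rewrite lerXn2r ?nnegrE ?powR_ge0.
rewrite /weight; have -> : (2 : R) ^+ 4 = 16 by ring.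
lra.
Qed.

Lemma continuous_chord_prod_powR n l : 0 <= l -> continuous (fun x => @chord_prod R n x `^ l).
Proof.
by move=> l0; apply: continuous_powR => //; [exact: continuous_chord_prod|exact: chord_prod_ge0].
Qed.

(** The product over [n+1] steps is [chord] times a function of [2x], so that the
transfer operator acts on [weight * chord^l] alone. *)
Lemma mean_weight_chord_prod n l : 0 <= l <= 1 ->
  mean (fun x => weight l x * chord_prod n x `^ l) <= 19 * (1 + 26 * l ^+ 2) ^+ n.
Proof.
move=> l01; have /andP[l0 l1] := l01.
have cw := continuous_weight l l0.
have cp m := continuous_chord_prod_powR m l l0.
have cg m : continuous (fun x => weight l x * chord_prod m x `^ l).
  by move=> x; apply: cvgM; [exact: cw|exact: cp].
elim: n => [|n IH].
  rewrite expr0 mulr1 -[leRHS](mean_cst 19); apply: le_mean => //.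
    exact: cst_continuous.
  by move=> x; rewrite /chord_prod big_ord0 powR1 mulr1 weight_le.
rewrite mean_transfer //.
have l2 : 0 <= 1 + 26 * l ^+ 2 by rewrite addr_ge0 // mulr_ge0 // sqr_ge0.
rewrite exprS mulrCA (le_trans _ (ler_wpM2l l2 IH)) // -meanZ //.
apply: le_mean.
- move=> x; apply: cvgM; first exact: cvg_cst.
  apply: cvgD; first exact: (continuous_scale _ _ (cg n.+1)).
  exact: (continuous_comp_affine _ _ _ (cg n.+1)).
- by move=> x; apply: cvgM; [exact: cvg_cst|exact: cg].
move=> x.
have -> : chord_prod n.+1 (2^-1 * x) = chord (2^-1 * x) * chord_prod n x.
  by rewrite chord_prodS mulrA divff // mul1r.
have -> : chord_prod n.+1 (2^-1 * (x + 1)) = chord (2^-1 * (x + 1)) * chord_prod n x.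
  by rewrite chord_prodS mulrA divff // mul1r chord_prod_periodic.
have [h1 h2] := chord_half x.
rewrite (@powRM R _ _ l (chord_ge0 (2^-1 * x)) (chord_prod_ge0 n x)).
rewrite (@powRM R _ _ l (chord_ge0 (2^-1 * (x + 1))) (chord_prod_ge0 n x)).
have := transfer_ineq l _ _ l01 (chord_ge0 _) (chord_ge0 _) h1.
rewrite h2 -/(weight l x).
move=> /(ler_wpM2l (powR_ge0 (chord_prod n x) l)); rewrite /weight; lra.
Qed.

(** For [l >= 1] the trivial bound [chord <= 2] suffices. *)
Lemma mean_chord_prod_powR n l : 0 <= l ->
  mean (fun x => chord_prod n x `^ l) <= 7 * expR (26 * l ^+ 2 * n%:R).
Proof.
move=> l0; have [l1|/ltW l1] := leP l 1.
  have l01 : 0 <= l <= 1 by rewrite l0.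
  have cp := continuous_chord_prod_powR n l l0.
  have h : 3 * mean (fun x => chord_prod n x `^ l) <= 19 * (1 + 26 * l ^+ 2) ^+ n.
    rewrite -meanZ // (le_trans _ (mean_weight_chord_prod n l l01)) //; apply: le_mean.
    - by move=> x; apply: cvgM; [exact: cvg_cst|exact: cp].
    - by move=> x; apply: cvgM; [exact: continuous_weight|exact: cp].
    - by move=> x; rewrite ler_wpM2r ?powR_ge0 // weight_ge3.
  have : (1 + 26 * l ^+ 2) ^+ n <= expR (26 * l ^+ 2 * n%:R).
    rewrite expRM_natr lerXn2r ?nnegrE ?expR_ge0 ?expR_ge1Dx //.
    by rewrite addr_ge0 // mulr_ge0 // sqr_ge0.
  by have := expR_ge0 (26 * l ^+ 2 * n%:R); lra.
rewrite -[leRHS](mean_cst (7 * _)); apply: le_mean.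
- exact: continuous_chord_prod_powR.
- exact: cst_continuous.
move=> x; have : chord_prod n x `^ l <= (2 ^+ n) `^ l.
  by rewrite ge0_ler_powR ?nnegrE ?chord_prod_ge0 ?chord_prod_le ?exprn_ge0.
move=> /le_trans; apply.
have -> : (2 ^+ n) `^ l = expR (l * (n%:R * ln 2)) :> R.
  by rewrite /powR gt_eqF ?exprn_gt0 // lnXn // mulr_natl.
have h : expR (l * (n%:R * ln 2)) <= expR (26 * l ^+ 2 * n%:R).
  rewrite ler_expR mulrCA [leRHS]mulrC ler_wpM2l //.
  have ln2 : ln 2 <= (2 : R) by rewrite ltW // ln_sublinear.
  rewrite (le_trans (ler_wpM2l l0 ln2)) //.
  by have := ler_wpM2l l0 l1; lra.
by have := expR_ge0 (26 * l ^+ 2 * n%:R); lra.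
Qed.

(** * Slow return of the orbit to 0 *)

(** A continuous substitute for [chord^(-3/4)], whose mean is bounded uniformly in
[dl].  The exponent has to be less than 1 for integrability and more than 1/2 for
the rate [(j+1)^2] in [slow_return]. *)
Definition damped (dl x : R) : R := ((dl + chord x) `^ (3 / 4))^-1.

Lemma damped_ge0 dl x : 0 <= damped dl x.
Proof. by rewrite invr_ge0 powR_ge0. Qed.

Lemma continuous_damped dl : 0 < dl -> continuous (damped dl).
Proof.
move=> dl0 x; apply: cvgV.
  by rewrite gt_eqF // powR_gt0 // ltr_wpDr ?chord_ge0.
apply: (continuous_powR (fun x => dl + chord x)) => [|y|y]; first by [].
  by apply: cvgD; [exact: cvg_cst|exact: continuous_chord].
by rewrite addr_ge0 ?chord_ge0 // ltW.
Qed.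

Definition damped_ratio : R := 2^-1 / (2^-1 `^ (3 / 4)).

Lemma damped_ratio_lt1 : damped_ratio < 1.
Proof.
rewrite /damped_ratio ltr_pdivrMr ?powR_gt0 ?invr_gt0 // mul1r.
rewrite /powR gt_eqF ?invr_gt0 //.
have ln2 : ln (2^-1 : R) < 0 by rewrite ln_lt0 // invr_gt0 ltr0n invf_lt1 // ltr1n.
rewrite -[ltLHS]lnK ?posrE ?invr_gt0 // ltr_expR; lra.
Qed.

(** Of the two preimages of a point only the nearer one to 0 can be close to 0, and
its chord is at least half of that of the point.  Averaging thus multiplies the
damped power by [2^(3/4) / 2 < 1], up to an additive constant. *)
Lemma damped_ineq dl (s c : R) : 0 < dl -> 0 <= s -> 0 <= c ->
  s ^+ 2 + c ^+ 2 = 4 ->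
  2^-1 * (((dl + s) `^ (3 / 4))^-1 + ((dl + c) `^ (3 / 4))^-1) <=
  damped_ratio * ((dl + s * c) `^ (3 / 4))^-1 + 2^-1.
Proof.
move=> dl0; wlog sc : s c / s <= c.
  move=> H s0 c0 sc4; have [/H|/ltW/H] := leP s c; first exact.
  by move=> /(_ c0 s0 (etrans (addrC _ _) sc4)); rewrite (mulrC c); lra.
move=> s0 c0 sc4; have /andP[c1 c2] := larger_half_chord s c s0 sc sc4.
have hc : ((dl + c) `^ (3 / 4))^-1 <= 1.
  have dc0 : 0 < dl + c by lra.
  rewrite invf_le1 ?powR_gt0 //.
  by rewrite -[leLHS](powRr0 (dl + c)) ler_powR //; lra.
have sc0 : 0 <= s * c by exact: mulr_ge0.
have hs : ((dl + s) `^ (3 / 4))^-1 <=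
    (2^-1 `^ (3 / 4))^-1 * ((dl + s * c) `^ (3 / 4))^-1.
  have hscl : s * c <= 2 * s by rewrite mulrC ler_wpM2r.
  have ds0 : 0 < dl + s by lra.
  have dsc0 : 0 <= dl + s * c by lra.
  have dsc1 : 0 < 2^-1 * (dl + s * c) by lra.
  rewrite -invfM -powRM ?invr_ge0 //.
  rewrite lef_pV2 ?posrE ?powR_gt0 //.
  by rewrite ge0_ler_powR ?nnegrE; lra.
by rewrite /damped_ratio; lra.
Qed.

Definition damped_const : R := 2^-1 / (1 - damped_ratio).

Lemma mean_damped dl : 0 < dl -> mean (damped dl) <= damped_const.
Proof.
move=> dl0; have cd := continuous_damped dl dl0.
have : mean (damped dl) <= damped_ratio * mean (damped dl) + 2^-1.
  have -> : damped_ratio * mean (damped dl) + 2^-1 =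
      mean (fun x => damped_ratio * damped dl x + 2^-1).
    rewrite meanD ?mean_cst ?meanZ //; last exact: cst_continuous.
    by move=> x; apply: cvgM; [exact: cvg_cst|exact: cd].
  rewrite mean_transfer //.
  apply: le_mean.
  - move=> x; apply: cvgM; first exact: cvg_cst.
    apply: cvgD; first exact: (continuous_scale _ _ cd).
    exact: (continuous_comp_affine _ _ _ cd).
  - move=> x; apply: cvgD; last exact: cvg_cst.
    by apply: cvgM; [exact: cvg_cst|exact: cd].
  move=> x; have [h1 h2] := chord_half x.
  by have := damped_ineq dl _ _ dl0 (chord_ge0 _) (chord_ge0 _) h1; rewrite h2.
rewrite /damped_const ler_pdivlMr ?subr_gt0 ?damped_ratio_lt1 //; lra.
Qed.

(** Comparison with the telescoping sum of [2 / sqrt j - 2 / sqrt (j+1)]. *)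
Lemma sum_invr_powR_three_halves n : \sum_(j < n) ((j.+1%:R : R) `^ (3 / 2))^-1 <= 3.
Proof.
suff : \sum_(j < n.+1) ((j.+1%:R : R) `^ (3 / 2))^-1 <= 3 - 2 / Num.sqrt n.+1%:R.
  rewrite big_ord_recr /=.
  have : 0 <= ((n.+1%:R : R) `^ (3 / 2))^-1 by rewrite invr_ge0 powR_ge0.
  have : 0 <= 2 / Num.sqrt (n.+1%:R : R) by rewrite mulr_ge0 // invr_ge0 sqrtr_ge0.
  by lra.
elim: n => [|n IH].
  by rewrite big_ord1 powR1 sqrtr1; lra.
rewrite big_ord_recr /=.
set a := Num.sqrt n.+1%:R in IH *; set b := Num.sqrt n.+2%:R.
have a0 : 0 < a by rewrite sqrtr_gt0.
have ab : a <= b by rewrite ler_wsqrtr // ler_nat.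
have a2 : a ^+ 2 = n.+1%:R by rewrite sqr_sqrtr.
have b2 : b ^+ 2 = n.+2%:R by rewrite sqr_sqrtr.
have ab1 : b ^+ 2 - a ^+ 2 = 1 by rewrite a2 b2 -addn1 natrD addrC addKr.
have b0 : 0 < b by lra.
have -> : (n.+2%:R : R) `^ (3 / 2) = b ^+ 3.
  have b0' := ltW b0.
  by rewrite -b2 -powR_mulrn // -powRrM -powR_mulrn //; congr powR; field.
have key : (b ^+ 3)^-1 <= 2 / a - 2 / b; last by lra.
have -> : 2 / a - 2 / b = 2 * (b ^+ 2 - a ^+ 2) / (a * b * (a + b)).
  field; by rewrite ?gt_eqF //; lra.
rewrite ab1 mulr1 -div1r ler_pdivrMr ?exprn_gt0 // mulrAC ler_pdivlMr; last first.
  by rewrite !mulr_gt0 //; lra.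
rewrite mul1r.
have : 0 <= b * (2 * b ^+ 2 - a * (a + b)).
  by rewrite mulr_ge0 ?ltW //; nra.
by rewrite exprS; lra.
Qed.

(** In this form the condition also says that no [2^j w] is an integer. *)
Definition slow_return w := exists C : R,
  forall j, 1 <= C * j.+1%:R ^+ 2 * chord (2 ^+ j * w).

Lemma chord_eq0_later w j n : chord (2 ^+ j * w) = 0 -> chord (2 ^+ (j + n) * w) = 0.
Proof.
move=> dj; elim: n => [|n IH]; first by rewrite addn0.
move: IH; rewrite addnS exprS -mulrA; set y := _ * w => /eqP.
rewrite /chord mulf_eq0 pnatr_eq0 /= normr_eq0 => /eqP sy.
have -> : pi * (2 * y) = (pi * y) *+ 2 by rewrite mulr2n; ring.
by rewrite sin_mulr2n sy mulr0 mul0rn normr0 mulr0.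
Qed.

(** Weighting the damped power of [chord (2^j w)] by [(j+1)^(-3/2)] gives a
convergent series of means, so that [dl j + chord (2^j w)] is almost everywhere at
least a constant times [((j+1)^(-3/2))^(4/3) = (j+1)^(-2)].  With
[dl j = (j+1)^(-3)] the damping is negligible for large [j]; for the others
[chord (2^j w)] is nonzero, since 0 is fixed by the doubling map. *)
Lemma ae_slow_return :
  {ae @lebesgue_measure R, forall w, `[0, 1]%classic w -> slow_return w}.
Proof.
pose c (j : nat) : R := (j.+1%:R `^ (3 / 2))^-1.
pose dl (j : nat) : R := (j.+1%:R ^+ 3)^-1.
have c0 j : 0 < c j by rewrite invr_gt0 powR_gt0.
have dl0 j : 0 < dl j by rewrite invr_gt0 exprn_gt0.
have cd j := continuous_damped (dl j) (dl0 j).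
pose g j x := c j * damped (dl j) (2 ^+ j * x).
have cg j : continuous (g j).
  by move=> x; apply: cvgM; [exact: cvg_cst|exact: (continuous_scale _ _ (cd j))].
have g0 j x : 0 <= g j x by rewrite mulr_ge0 ?damped_ge0 ?ltW.
have gM n : \sum_(j < n) mean (g j) <= 3 * damped_const.
  have K0 : 0 <= damped_const.
    by rewrite mulr_ge0 // invr_ge0 subr_ge0 ltW // damped_ratio_lt1.
  rewrite (le_trans _ (ler_wpM2r K0 (sum_invr_powR_three_halves n))) // mulr_suml.
  apply: ler_sum => j _; rewrite /g meanZ; last exact: (continuous_scale _ _ (cd j)).
  rewrite mean_double //; last by move=> x; rewrite /damped -{1}[1]/1%:R chord_periodic.
  by rewrite ler_wpM2l ?mean_damped // ltW.
move: (ae_bounded g _ cg g0 gM).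
apply: filterS; first exact: (ae_filter_ringOfSetsType (@lebesgue_measure R)).
move=> w h w01; have [G gG] := h w01.
pose H := Num.max G 1; have H0 : 0 < H by rewrite lt_max ltr01 orbT.
pose K := H `^ (4 / 3); have K0 : 0 < K by rewrite powR_gt0.
have lower j : (K * j.+1%:R ^+ 2)^-1 <= dl j + chord (2 ^+ j * w).
  set y := dl j + _.
  have y0 : 0 < y by rewrite ltr_wpDr ?chord_ge0.
  have := gG j; rewrite /g /damped -/y /c -invfM => gj.
  have {}gj : (j.+1%:R `^ (3 / 2) * y `^ (3 / 4))^-1 <= H.
    by rewrite (le_trans gj) // le_max lexx.
  have p0 : 0 < j.+1%:R `^ (3 / 2) * y `^ (3 / 4) by rewrite mulr_gt0 ?powR_gt0.
  have {}gj : 1 <= H * (j.+1%:R `^ (3 / 2) * y `^ (3 / 4)).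
    by rewrite -ler_pdivrMr // div1r.
  have : 1 `^ (4 / 3) <= (H * (j.+1%:R `^ (3 / 2) * y `^ (3 / 4))) `^ (4 / 3).
    by rewrite ge0_ler_powR ?nnegrE // mulr_ge0 ?ltW.
  rewrite powR1 !powRM ?mulr_ge0 ?powR_ge0 ?(ltW H0) // -!powRrM.
  have -> : 3 / 2 * (4 / 3) = 2%:R :> R by field.
  have -> : 3 / 4 * (4 / 3) = 1 :> R by field.
  rewrite powR_mulrn // powRr1 ?(ltW y0) // -/K mulrA => hh.
  by rewrite -div1r ler_pdivrMr ?mulr_gt0 ?exprn_gt0 // mulrC.
have eventually j : 2 * K <= j.+1%:R -> 1 <= 2 * K * j.+1%:R ^+ 2 * chord (2 ^+ j * w).
  move=> jK; set n : R := j.+1%:R in jK *.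
  have n0 : 0 < n by rewrite ltr0n.
  have := lower j; rewrite -/n /dl -/n => low.
  have low2 : 1 <= K * n ^+ 2 * ((n ^+ 3)^-1 + chord (2 ^+ j * w)).
    by rewrite mulrC -ler_pdivrMr ?mulr_gt0 ?exprn_gt0 // div1r.
  have e3 : K * n ^+ 2 * (n ^+ 3)^-1 <= 2^-1.
    have -> : K * n ^+ 2 * (n ^+ 3)^-1 = K / n by field; rewrite gt_eqF.
    by rewrite ler_pdivrMr // mulrC ler_pdivlMr // mulrC.
  move: low2 e3; set v := (n ^+ 3)^-1; set D := chord _; set m := K * n ^+ 2.
  by rewrite (_ : 2 * K * n ^+ 2 = 2 * m) /m; [lra|ring].
pose J := (Num.truncn (2 * K)).+1.
have JP j : (J <= j)%N -> 2 * K <= j.+1%:R.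
  move=> Jj; rewrite ltW // (lt_le_trans (truncnS_gt _)) // ler_nat.
  by rewrite (leq_trans Jj).
have dpos j : 0 < chord (2 ^+ j * w).
  rewrite lt_neqAle chord_ge0 andbT eq_sym; apply/eqP => dj.
  have := eventually (j + J)%N (JP _ (leq_addl _ _)).
  by rewrite chord_eq0_later // mulr0 ler10.
exists (2 * K + \sum_(i < J) (chord (2 ^+ i * w))^-1) => j.
have S0 : 0 <= \sum_(i < J) (chord (2 ^+ i * w))^-1.
  by apply: sumr_ge0 => i _; rewrite invr_ge0 chord_ge0.
have n2 : 1 <= (j.+1%:R : R) ^+ 2 by rewrite exprn_ege1 // ler1n.
have [/JP/eventually|jJ] := leqP J j.
  move=> /le_trans; apply; rewrite ler_wpM2r ?chord_ge0 // ler_wpM2r ?exprn_ge0 //.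
  by rewrite lerDl.
have hj : (chord (2 ^+ j * w))^-1 <= 2 * K + \sum_(i < J) (chord (2 ^+ i * w))^-1.
  rewrite (bigD1 (Ordinal jJ)) //= ler_wpDl ?mulr_ge0 ?(ltW K0) // lerDl.
  by apply: sumr_ge0 => i _; rewrite invr_ge0 chord_ge0.
rewrite -ler_pdivrMr // div1r (le_trans hj) // ler_peMr //.
by rewrite addr_ge0 // mulr_ge0 // ltW.
Qed.

End Means.

(** * Dyadic chaining *)

Section Chaining.
Context {R : realType}.
Implicit Types (w x : R) (E : nat -> R) (i j k m n : nat).

(** An initial segment of length [j < 2^k] is cut, along the binary digits of [j],
into at most one dyadic block of each length [2^i], [i < k]. *)
Lemma dyadic_chaining k w E : (forall i, 1 <= E i) ->
  (forall i m, (i < k)%N -> (m < 2 ^ (k - i))%N ->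
     chord_prod (2 ^ i) (2 ^+ (m * 2 ^ i) * w) <= E i) ->
  forall j, (j < 2 ^ k)%N -> chord_prod j w <= \prod_(i < k) E i.
Proof.
move=> E1 blk.
have E0 i : 0 <= E i by rewrite (le_trans ler01).
have P0 i : 0 <= \prod_(i' < i) E i' by apply: prodr_ge0.
suff H i m j : (i <= k)%N -> (m < 2 ^ (k - i))%N -> (j < 2 ^ i)%N ->
    chord_prod j (2 ^+ (m * 2 ^ i) * w) <= \prod_(i' < i) E i'.
  move=> j jk; have := H k 0%N j (leqnn k).
  by rewrite subnn mul0n expr0 mul1r; apply.
elim: i m j => [|i IH] m j ik mk.
  by rewrite ltnS leqn0 => /eqP->; rewrite /chord_prod !big_ord0.
have Em : (m * 2 ^ i.+1 = m.*2 * 2 ^ i)%N by rewrite expnS mulnA muln2.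
have ki : (2 ^ (k - i) = 2 * 2 ^ (k - i.+1))%N by rewrite -expnS subnSK.
have m2 : (m.*2 < 2 ^ (k - i))%N by rewrite ki mul2n ltn_double.
have m3 : (m.*2.+1 < 2 ^ (k - i))%N by rewrite ki mul2n ltn_Sdouble.
rewrite Em big_ord_recr /= => ji; have [jl|jl] := ltnP j (2 ^ i).
  by rewrite (le_trans (IH _ _ (ltnW ik) m2 jl)) // ler_peMr.
rewrite -(subnKC jl) chord_prodD mulrC mulrA -exprD -mulSn.
apply: ler_pM; rewrite ?chord_prod_ge0 //; last exact: blk.
by apply: IH; rewrite ?(ltnW ik) //; rewrite expnS in ji; lia.
Qed.

(** Writing [2^i = (root4^i)^4] keeps all fractional powers of 2 integral powers of
[root4]. *)
Definition root4 : R := Num.sqrt (Num.sqrt 2).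

Lemma root4X : root4 ^+ 4 = 2.
Proof. by rewrite (exprM _ 2 2) !sqr_sqrtr ?sqrtr_ge0. Qed.

Lemma root4_ge : 7 / 6 <= root4.
Proof.
rewrite leNgt; apply/negP => h.
have r0 : 0 <= root4 by rewrite sqrtr_ge0.
have : root4 ^+ 4 < (7 / 6) ^+ 4 by rewrite ltrXn2r.
rewrite root4X; have -> : (7 / 6 : R) ^+ 4 = 2401 / 1296 by field.
by lra.
Qed.

Lemma root4_ge1 : 1 <= root4. Proof. by have := root4_ge; lra. Qed.

Lemma root4X_gt0 n : 0 < root4 ^+ n.
Proof. by rewrite exprn_gt0 // (lt_le_trans ltr01) // root4_ge1. Qed.

Lemma root4X_ge1 n : 1 <= root4 ^+ n.
Proof. by rewrite exprn_ege1 // root4_ge1. Qed.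

(** The series has ratio [root4 >= 7/6], and [1 / (7/6 - 1) = 6]. *)
Lemma geometric_root4 k : \sum_(i < k) root4 ^+ i <= 6 * root4 ^+ k.
Proof.
elim: k => [|k IH]; first by rewrite big_ord0 expr0 mulr1.
rewrite big_ord_recr /= exprSr.
have := ler_wpM2l (ltW (root4X_gt0 k)) root4_ge; lra.
Qed.

Lemma linear_le_root4 n : n%:R <= 2 * (root4 ^+ n) ^+ 2.
Proof.
suff [] : n%:R <= 2 * (root4 ^+ n) ^+ 2 /\ n.+1%:R <= 2 * (root4 ^+ n.+1) ^+ 2 by [].
have ge1 m : 1 <= (root4 ^+ m) ^+ 2 by rewrite exprn_ege1 // root4X_ge1.
elim: n => [|n [IH1 IH2]].
  split; first by rewrite expr0 expr1n mulr1.
  by have := ge1 1%N; lra.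
split => //.
have -> : (root4 ^+ n.+2) ^+ 2 = 2 * (root4 ^+ n) ^+ 2.
  by rewrite -root4X -!exprM -exprD; congr (_ ^+ _); lia.
by have := ge1 n; rewrite -addn2 natrD; lra.
Qed.

(** The square root of the iterated logarithm at the length scale [2^k]. *)
Definition tau k : R := Num.sqrt (ln k.+2%:R).

Lemma tau_sqr k : tau k ^+ 2 = ln k.+2%:R.
Proof. by rewrite sqr_sqrtr // ln_ge0 // ler1n. Qed.

Lemma ln2_le_tau k : ln 2 <= tau k ^+ 2.
Proof. by rewrite tau_sqr ler_ln ?posrE // ler_nat. Qed.

Lemma tau_gt0 k : 0 < tau k.
Proof. by rewrite sqrtr_gt0 ln_gt0 // ltr1n. Qed.

(** The exponent of the moment of a block of length [2^i] that is used at scale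
[2^k].  The Gaussian cost of the deviation [31 * tau k * root4^(k+i)] then grows with [k - i]
fast enough to pay for the [2^(k-i)] blocks of that length, while the deviations
of the different lengths still form a geometric series. *)
Definition tilt k i : R := tau k * root4 ^+ (k - i) / (root4 ^+ i) ^+ 2.

Lemma tilt_gt0 k i : 0 < tilt k i.
Proof. by rewrite !mulr_gt0 ?tau_gt0 ?root4X_gt0 // invr_gt0 exprn_gt0 ?root4X_gt0. Qed.

Definition cost k i : R := tau k ^+ 2 * (root4 ^+ (k - i)) ^+ 2.

Lemma tilt_sqr k i : tilt k i ^+ 2 * (2 ^ i)%:R = cost k i.
Proof.
rewrite natrX -root4X -exprM mulnC exprM /tilt /cost.
by field; rewrite gt_eqF ?root4X_gt0.
Qed.

Lemma tilt_scale k i : (i <= k)%N ->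
  tilt k i * (root4 ^+ k * root4 ^+ i) = tau k * (root4 ^+ (k - i)) ^+ 2.
Proof.
move=> ik; have -> : root4 ^+ k = root4 ^+ (k - i) * root4 ^+ i.
  by rewrite -exprD subnK.
rewrite /tilt.
by field; rewrite gt_eqF ?root4X_gt0.
Qed.

Lemma tau_sqr_le_cost k i : tau k ^+ 2 <= cost k i.
Proof. by rewrite ler_peMr ?sqr_ge0 // exprn_ege1 // root4X_ge1. Qed.

(** The factor 31 exceeds 26, the constant of the moment bound, by 5: 2 for the
number of blocks and 3 for summability over the scales. *)
Definition block k i m x : R :=
  expR (- (31 * cost k i)) * chord_prod (2 ^ i) (2 ^+ (m * 2 ^ i) * x) `^ tilt k i.

Definition blocks k x : R := \sum_(i < k) \sum_(m < 2 ^ (k - i)) block k i m x.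

Lemma block_ge0 k i m x : 0 <= block k i m x.
Proof. by rewrite mulr_ge0 ?expR_ge0 ?powR_ge0. Qed.

Lemma continuous_block k i m : continuous (block k i m).
Proof.
move=> x; apply: cvgM; first exact: cvg_cst.
apply: (continuous_scale (fun x => chord_prod (2 ^ i) x `^ tilt k i)).
exact: continuous_chord_prod_powR (ltW (tilt_gt0 k i)).
Qed.

Lemma continuous_blocks k : continuous (blocks k).
Proof.
by apply: continuous_sum => i; apply: continuous_sum => m; exact: continuous_block.
Qed.

Lemma mean_block k i m :
  mean (block k i m) <= 7 * expR (- (5 * cost k i)).
Proof.
have t0 := ltW (tilt_gt0 k i).
have cp := continuous_chord_prod_powR (2 ^ i) _ t0.
rewrite /block meanZ; last exact: (continuous_scale _ _ cp).
rewrite (mean_double (fun x => chord_prod (2 ^ i) x `^ tilt k i)) //; last first.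
  by move=> x; rewrite chord_prod_periodic.
have := ler_wpM2l (expR_ge0 (- (31 * cost k i))) (mean_chord_prod_powR (2 ^ i) _ t0).
move=> /le_trans; apply.
rewrite -mulrA tilt_sqr mulrCA -expRD.
by rewrite ler_pM2l // ler_expR; lra.
Qed.

Lemma mean_blocks k : mean (blocks k) <= 7 * (k.+1%:R^-1 - k.+2%:R^-1).
Proof.
rewrite /blocks mean_sum; last first.
  by move=> i; apply: continuous_sum => m; exact: continuous_block.
have inner (i : 'I_k) :
    mean (fun x => \sum_(m < 2 ^ (k - i)) block k i m x) <= 7 * (k.+2%:R ^+ 3)^-1.
  rewrite mean_sum; last by move=> m; exact: continuous_block.
  rewrite (le_trans (ler_sum _ (fun (m : 'I_(2 ^ (k - i))) _ => mean_block k i m))) //.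
  rewrite sumr_const card_ord -[leLHS]mulr_natl mulrCA ler_pM2l //.
  have -> : (2 ^ (k - i))%:R = expR ((k - i)%:R * ln 2) :> R.
    by rewrite expRM_natl lnK ?posrE // natrX.
  have -> : (k.+2%:R ^+ 3)^-1 = expR (- (3 * tau k ^+ 2)) :> R.
    rewrite expRN tau_sqr; congr (_^-1).
    by rewrite expRM_natl lnK ?posrE.
  rewrite -expRD ler_expR.
  have h : (k - i)%:R * ln 2 <= 2 * cost k i.
    have l2 : 0 <= ln 2 :> R by rewrite ln_ge0 // ler1n.
    rewrite (le_trans (ler_pM _ l2 (linear_le_root4 (k - i)) (ln2_le_tau k))) //.
    by rewrite /cost; lra.
  by have := tau_sqr_le_cost k i; lra.
rewrite (le_trans (ler_sum _ (fun (i : 'I_k) _ => inner i))) //.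
rewrite sumr_const card_ord -[leLHS]mulr_natl mulrCA ler_pM2l //.
set a : R := k.+1%:R; have a1 : 1 <= a by rewrite ler1n.
have kE : k%:R = a - 1 by rewrite /a -addn1 natrD addrK.
have -> : k.+2%:R = a + 1 by rewrite /a -[k.+2]addn1 natrD.
have -> : a^-1 - (a + 1)^-1 = (a * (a + 1))^-1.
  by field; rewrite !gt_eqF //; lra.
have a_gt0 : 0 < a by lra.
have a1_gt0 : 0 < a + 1 by lra.
rewrite kE -[leRHS]div1r ler_pdivrMr ?exprn_gt0 //.
rewrite mulrAC ler_pdivlMr ?mulr_gt0 // mul1r.
have : (a + 1) ^+ 3 - (a - 1) * (a * (a + 1)) = (3 * a + 1) * (a + 1) by ring.
have : 0 <= (3 * a + 1) * (a + 1) by rewrite mulr_ge0 //; lra.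
by lra.
Qed.

Lemma sum_mean_blocks n : \sum_(k < n) mean (blocks k) <= 7.
Proof.
rewrite (@le_trans _ _ (7 * (1 - n.+1%:R^-1))) //; last first.
  by rewrite -[leRHS]mulr1 ler_pM2l // gerBl invr_ge0.
elim: n => [|n IH]; first by rewrite big_ord0 invr1 subrr mulr0.
rewrite big_ord_recr /=; have := mean_blocks n.
move: IH; set u := n.+1%:R^-1; set v := n.+2%:R^-1; lra.
Qed.

(** Upper half of the law of the iterated logarithm, as [tau k * (root4^k)^2] is
the square root of [2^k ln (k+2)].  The constant is [192 = 6 * (31 + 1)], with 6
from [geometric_root4] and 31 from [block]. *)
Definition sqrt_growth w := exists2 C : R, 0 <= C & forall k j, (j < 2 ^ k)%N ->
  chord_prod j w <= C * expR (192 * tau k * (root4 ^+ k) ^+ 2).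

(** Each block of length [2^i] is at most [exp] of a multiple of
[root4^(k+i)], and these exponents are summed by [geometric_root4]. *)
Lemma chord_prod_of_blocks k w (G : R) : 1 <= G -> blocks k w <= G ->
  forall j, (j < 2 ^ k)%N ->
  chord_prod j w <= expR (6 * (ln G / tau k + 31 * tau k) * (root4 ^+ k) ^+ 2).
Proof.
move=> G1 bG; set Z := ln G / tau k + 31 * tau k.
have lG : 0 <= ln G by rewrite ln_ge0.
have t0 := tau_gt0 k.
have Z0 : 0 <= Z by rewrite addr_ge0 ?mulr_ge0 ?invr_ge0 // ltW.
pose E i := expR (Z * (root4 ^+ k * root4 ^+ i)).
have E1 i : 1 <= E i.
  by rewrite -[leLHS]expR0 ler_expR mulr_ge0 // mulr_ge0 // ltW // root4X_gt0.
have blk i m : (i < k)%N -> (m < 2 ^ (k - i))%N ->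
    chord_prod (2 ^ i) (2 ^+ (m * 2 ^ i) * w) <= E i.
  move=> ik mk; set Q := chord_prod _ _.
  have : 0 <= Q by exact: chord_prod_ge0.
  rewrite le_eqVlt => /predU1P[<-|Q0]; first exact: expR_ge0.
  have : block k i m w <= G.
    rewrite (le_trans _ bG) // /blocks (bigD1 (Ordinal ik)) //=.
    rewrite (bigD1 (Ordinal mk)) //= -addrA lerDl addr_ge0 //.
      by apply: sumr_ge0 => ? _; exact: block_ge0.
    by apply: sumr_ge0 => ? _; apply: sumr_ge0 => ? _; exact: block_ge0.
  rewrite /block -/Q /powR gt_eqF // -[leRHS]lnK ?posrE ?(lt_le_trans ltr01) //.
  rewrite -expRD ler_expR => h.
  rewrite -[leLHS]lnK ?posrE // ler_expR -(ler_pM2l (tilt_gt0 k i)).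
  rewrite mulrCA tilt_scale ?(ltnW ik) //.
  set rho := (root4 ^+ (k - i)) ^+ 2.
  have rho1 : 1 <= rho by rewrite exprn_ege1 // root4X_ge1.
  have -> : Z * (tau k * rho) = ln G * rho + 31 * cost k i.
    by rewrite /Z /cost -/rho; field; rewrite gt_eqF.
  have := ler_peMr lG rho1.
  by lra.
move=> j jk; rewrite (le_trans (dyadic_chaining k w E E1 blk j jk)) //.
rewrite /E -expR_sum ler_expR -mulr_sumr -mulr_sumr.
have := ler_wpM2l Z0 (ler_wpM2l (ltW (root4X_gt0 k)) (geometric_root4 k)).
move=> /le_trans; apply; lra.
Qed.

(** The almost sure bound [G] enters the exponent as [ln G / tau k], which is at
most [tau k] as soon as [k + 2 >= G]. *)
Lemma ae_sqrt_growth :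
  {ae @lebesgue_measure R, forall w, `[0, 1]%classic w -> sqrt_growth w}.
Proof.
have b0 k x : 0 <= blocks k x.
  by apply: sumr_ge0 => i _; apply: sumr_ge0 => m _; exact: block_ge0.
move: (ae_bounded blocks _ continuous_blocks b0 sum_mean_blocks).
apply: filterS; first exact: (ae_filter_ringOfSetsType (@lebesgue_measure R)).
move=> w h w01; have [C bC] := h w01.
pose G := Num.max C 1.
have G1 : 1 <= G by rewrite le_max lexx orbT.
have bG k : blocks k w <= G by rewrite (le_trans (bC k)) // le_max lexx.
pose K := Num.truncn G.
have C1 : 1 <= 2 ^+ (2 ^ K) :> R by rewrite exprn_ege1 // ler1n.
exists (2 ^+ (2 ^ K)) => [|k j jk]; first by rewrite (le_trans ler01).
have X0 : 0 <= (root4 ^+ k) ^+ 2 by rewrite sqr_ge0.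
have t0 := tau_gt0 k.
have [kG|kG] := lerP G k.+2%:R.
  rewrite (le_trans (chord_prod_of_blocks k w G G1 (bG k) j jk)) //.
  rewrite (le_trans _ (ler_peMl (expR_ge0 _) C1)) // ler_expR ler_wpM2r //.
  have : ln G / tau k <= tau k.
    rewrite ler_pdivrMr // -expr2 tau_sqr ler_ln ?posrE ?ltr0n //.
    exact: lt_le_trans G1.
  by lra.
have kK : (k <= K)%N.
  have : (k.+2 <= K)%N by rewrite /K truncn_ge_nat ?(ltW kG) // (le_trans ler01).
  lia.
rewrite (le_trans (chord_prod_le j w)) //.
rewrite (@le_trans _ _ (2 ^+ (2 ^ K))) //.
  by rewrite ler_weXn2l ?ler1n // ltnW // (leq_trans jk) // leq_exp2l.
rewrite ler_peMr ?(le_trans ler01 C1) // -[leLHS]expR0 ler_expR.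
exact: mulr_ge0 (mulr_ge0 (ler0n _ _) (ltW t0)) X0.
Qed.

End Chaining.

(** * Rates for typical frequencies *)

Section Growth.
Context {R : realType}.
Implicit Types (w C : R) (A a : seq nat) (rho : nat -> R) (i j k m n p q N : nat).

Definition typical w := slow_return w /\ sqrt_growth w.

Lemma slow_return_gt0 w : slow_return w -> exists2 C : R, 0 < C &
  forall j, 1 <= C * j.+1%:R ^+ 2 * chord (2 ^+ j * w).
Proof.
move=> [C hC]; exists C => //.
have := hC 0%N; rewrite expr1n mulr1 => h; rewrite ltNge; apply/negP => C0.
have := mulr_le0_ge0 C0 (chord_ge0 (2 ^+ 0 * w)); lra.
Qed.

Lemma slow_return_chord_gt0 w j : slow_return w -> 0 < chord (2 ^+ j * w).
Proof.
move=> [C hC]; rewrite lt_neqAle chord_ge0 andbT eq_sym; apply/eqP => dj.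
by have := hC j; rewrite dj mulr0 ler10.
Qed.

Lemma typical_double w : typical w -> typical (2 * w).
Proof.
move=> [sw [D D0 hD]]; have [C C0 hC] := slow_return_gt0 w sw.
have d0 : 0 < chord w by have := slow_return_chord_gt0 w 0 sw; rewrite mul1r.
split.
  exists (4 * C) => j; rewrite mulrA -exprSr (le_trans (hC j.+1)) //.
  rewrite ler_wpM2r ?chord_ge0 // (mulrC 4) -mulrA ler_pM2l //.
  have -> : 4 * j.+1%:R ^+ 2 = (2 * j.+1%:R) ^+ 2 :> R by ring.
  rewrite lerXn2r ?nnegrE ?mulr_ge0 // -natrM ler_nat; lia.
exists (2 / chord w * D) => [|k j jk].
  by rewrite mulr_ge0 // mulr_ge0 // invr_ge0 ltW.
have -> : chord_prod j (2 * w) = (chord w)^-1 * chord_prod j.+1 w.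
  by rewrite chord_prodS mulrA mulVf ?mul1r // gt_eqF.
have hj := hD k j jk; set X := expR _ in hj *.
rewrite (_ : 2 / chord w * D * X = (chord w)^-1 * (2 * (D * X))); last by ring.
rewrite ler_pM2l ?invr_gt0 // /chord_prod big_ord_recr /= -/(chord_prod j w) mulrC.
exact: (ler_pM (chord_ge0 _) (chord_prod_ge0 _ _) (chord_le2 _) hj).
Qed.

Lemma ae_typical :
  {ae @lebesgue_measure R, forall w, w \in `[0, 1[ -> typical w}.
Proof.
move: (@ae_slow_return R) (@ae_sqrt_growth R); apply: filterS2.
  exact: (ae_filter_ringOfSetsType (@lebesgue_measure R)).
move=> w h1 h2 w01.
have w01' : `[0, 1]%classic w.
  by move: w01; rewrite /= !in_itv /= => /andP[-> /ltW ->].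
by split; [exact: h1|exact: h2].
Qed.

Lemma ln2_ge : 2^-1 <= ln 2 :> R.
Proof.
rewrite -[leLHS]expRK ler_ln ?posrE ?expR_gt0 //.
have := expR_ge1Dx (- 2^-1 : R); rewrite expRN => h.
have := ler_wpM2l (expR_ge0 2^-1) h.
by rewrite divff ?expR_eq0 //; lra.
Qed.

Lemma ln_pow2 m : m%:R * 2^-1 <= ln (2 ^ m)%:R :> R.
Proof. by rewrite natrX lnXn // -[leRHS]mulr_natl ler_wpM2l // ln2_ge. Qed.

Lemma ln_ge1 N : (16 <= N)%N -> 1 <= ln N%:R :> R.
Proof.
move=> N16; rewrite (@le_trans _ _ (ln (2 ^ 4)%:R)) //.
  by rewrite (le_trans _ (ln_pow2 4)) //; lra.
by rewrite ler_ln ?posrE ?ltr0n ?ler_nat //; lia.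
Qed.

Lemma log2_scale N : (16 <= N)%N -> exists n,
  [/\ (0 < n)%N, (N < 2 ^ n)%N & n%:R <= 4 * ln N%:R :> R].
Proof.
move=> N16; exists (trunc_log 2 N).+1; split=> //; first exact: trunc_log_ltn.
have N0 : (0 < N)%N by lia.
have h := trunc_logP (isT : (1 < 2)%N) N0.
have h4 : (4 <= trunc_log 2 N)%N by rewrite trunc_log_max.
have {}h : ln (2 ^ trunc_log 2 N)%:R <= ln N%:R :> R.
  by rewrite ler_ln ?posrE ?ltr0n ?expn_gt0 // ler_nat.
have := ln_pow2 (trunc_log 2 N).
move: h4; rewrite -(ler_nat R) -natr1; lra.
Qed.

(** The rates for an odd and for an even number of factors. *)
Definition odd_rate N : R :=
  ln N%:R * expR (192 * 4 * Num.sqrt (ln N%:R * ln (ln (ln N%:R)))).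

Definition even_rate N : R := ln N%:R ^+ 3.

Lemma odd_rate_ge1 N : (16 <= N)%N -> 1 <= odd_rate N.
Proof.
move=> N16; rewrite /odd_rate -[leLHS]mulr1 ler_pM ?ln_ge1 //.
have B0 : 0 <= 192 * 4 :> R by rewrite mulr_ge0 ?ler0n.
by rewrite -[leLHS]expR0 ler_expR (mulr_ge0 B0 (sqrtr_ge0 _)).
Qed.

Lemma even_rate_ge1 N : (16 <= N)%N -> 1 <= even_rate N.
Proof. by move=> N16; rewrite exprn_ege1 // ln_ge1. Qed.

(** When [2^(k-1) <= n <= 4 ln N], three logarithms of [N] are at least
[ln ((k - 3) / 2)], which is at least half of [ln (k+2)] once
[(k - 3)^2 >= 4 (k + 2)], as for [k >= 10]. *)
Lemma tau_le_logloglog : exists k0, forall n k N, (16 <= N)%N -> (0 < n)%N ->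
  (k0 <= k)%N ->
  (2 ^ k <= 2 * n)%N -> n%:R <= 4 * ln N%:R :> R ->
  tau k * (root4 ^+ k) ^+ 2 <= 4 * Num.sqrt (ln N%:R * ln (ln (ln N%:R))) :> R.
Proof.
exists 10%N => n k N N16 n0 k10 kn nN; set L : R := ln N%:R in nN *.
have L1 : 1 <= L by exact: ln_ge1.
have kL : (2 ^ k)%:R <= 8 * L.
  by move: kn; rewrite -(ler_nat R) natrM; lra.
have kE : (2 ^ k = 2 ^ 3 * 2 ^ (k - 3))%N by rewrite -expnD subnKC //; lia.
have kL' : (2 ^ (k - 3))%:R <= L.
  by move: kL; rewrite kE natrM; lra.
have LL : (k - 3)%:R * 2^-1 <= ln L.
  rewrite (le_trans (ln_pow2 (k - 3))) // ler_ln ?posrE ?ltr0n ?expn_gt0 //; lra.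
have k7 : 7 <= (k - 3)%:R :> R by rewrite ler_nat; lia.
have kk : k.+2%:R = (k - 3)%:R + 5 :> R by rewrite -natrD; congr _%:R; lia.
set y : R := (k - 3)%:R in LL k7 kk.
have LLL : ln k.+2%:R <= 2 * ln (ln L).
  rewrite mulr_natl -lnXn; last by lra.
  rewrite ler_ln ?posrE ?ltr0n ?exprn_gt0 //; last by lra.
  rewrite kk (@le_trans _ _ ((y * 2^-1) ^+ 2)) //.
    by rewrite expr2; nra.
  by rewrite lerXn2r ?nnegrE //; lra.
have -> : 4 * Num.sqrt (L * ln (ln L)) = Num.sqrt (16 * (L * ln (ln L))).
  rewrite (_ : 16 * (L * ln (ln L)) = 4 ^+ 2 * (L * ln (ln L))); last by ring.
  by rewrite [in RHS]sqrtrM ?sqr_ge0 // sqrtr_sqr ger0_norm.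
rewrite -[leLHS]ger0_norm; last by rewrite mulr_ge0 ?sqr_ge0 // ltW // tau_gt0.
rewrite -sqrtr_sqr ler_wsqrtr // exprMn tau_sqr.
have -> : ((root4 ^+ k) ^+ 2) ^+ 2 = (2 ^ k)%:R :> R.
  by rewrite natrX -root4X -!exprM; congr (_ ^+ _); lia.
have l0 : 0 <= ln k.+2%:R :> R by rewrite ln_ge0 // ler1n.
have := ler_pM l0 (ler0n _ _) LLL kL; lra.
Qed.

Lemma tm_bounded_single w : typical w -> tm_bounded odd_rate [:: 0%N] w.
Proof.
move=> [_ [C C0 hC]].
have [K0 small] := tau_le_logloglog.
have M0 : 0 <= 2 ^+ (2 ^ K0) :> R by rewrite exprn_ge0.
exists (8 * C + 2 ^+ (2 ^ K0)) => [|N p q N16 qpN].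
  by rewrite addr_ge0 // mulr_ge0.
have [n [n0 Nn nN]] := log2_scale N N16.
pose k := (trunc_log 2 n).+1.
have nk : (n < 2 ^ k)%N by exact: trunc_log_ltn.
have kn : (2 ^ k <= 2 * n)%N by rewrite expnS leq_mul2l /= trunc_logP.
have rho0 : 0 <= odd_rate N by rewrite (le_trans ler01) // odd_rate_ge1.
rewrite mulrDl; have [k10|k10] := leqP K0 k; last first.
  (* Windows too short for the asymptotic comparison are bounded trivially. *)
  apply: ler_wpDl; first exact: mulr_ge0 (mulr_ge0 (ler0n _ _) C0) rho0.
  apply: le_trans (ler_peMr M0 (odd_rate_ge1 N N16)).
  apply: (@le_trans _ _ (q - p)%:R).
    by rewrite /tm_sum; apply: normc_le_card => j; rewrite normc_signe.
  rewrite -natrX ler_nat (leq_trans qpN) // (leq_trans (ltnW Nn)) //.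
  by rewrite leq_exp2l // (leq_trans (ltnW nk)) // leq_exp2l // ltnW.
apply: ler_wpDr; first exact: mulr_ge0 M0 rho0.
have lg := small n k N N16 n0 k10 kn nN.
rewrite (le_trans (tm_sum_single_bound n p q w (leq_ltn_trans qpN Nn))) //.
pose X : R := expR (192 * 4 * Num.sqrt (ln N%:R * ln (ln (ln N%:R)))).
have term (j : 'I_n) : chord_prod j w <= C * X.
  rewrite (le_trans (hC k j (ltn_trans (ltn_ord j) nk))) // ler_wpM2l //.
  by rewrite ler_expR; lra.
have : \sum_(j < n) chord_prod j w <= n%:R * (C * X).
  rewrite (le_trans (ler_sum _ (fun (j : 'I_n) _ => term j))) //.
  by rewrite sumr_const card_ord -[leLHS]mulr_natl.
have CX : 0 <= C * X by rewrite mulr_ge0 // expR_ge0.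
have := ler_wpM2r CX nN; rewrite /odd_rate -/X; lra.
Qed.

Lemma tm_bounded_nil w : typical w -> tm_bounded even_rate [::] w.
Proof.
move=> [sw _]; have d0 : 0 < chord w by have := slow_return_chord_gt0 w 0 sw; rewrite mul1r.
have c0 : 0 <= 2 / chord w by rewrite mulr_ge0 // invr_ge0 ltW.
exists (2 / chord w) => // N p q N16 _.
rewrite (@le_trans _ _ (2 / chord w)) //.
  by rewrite ler_pdivlMr // mulrC tm_sum_nil_bound.
by rewrite ler_peMr // even_rate_ge1.
Qed.

Lemma tm_bounded_pair w : typical w -> tm_bounded even_rate [:: 0; 1]%N w.
Proof.
move=> [sw _]; have [C C0 hC] := slow_return_gt0 w sw.
have dpos j := slow_return_chord_gt0 w j sw.
exists ((2 + 8 * C) * 64) => [|N p q N16 qpN].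
  by rewrite mulr_ge0 // addr_ge0 // mulr_ge0 // ltW.
have [n [n0 Nn nN]] := log2_scale N N16.
rewrite (le_trans (tm_sum_pair_bound n p q w dpos (leq_ltn_trans qpN Nn))) //.
set x : R := n%:R in nN *; have x1 : 1 <= x by rewrite ler1n.
have x2 : 1 <= x ^+ 2 by rewrite exprn_ege1.
have term (j : 'I_n) : 2 + 2 / chord (2 ^+ j.+1 * w) <= (2 + 8 * C) * x ^+ 2.
  have jx : j.+2%:R ^+ 2 <= 4 * x ^+ 2.
    have -> : 4 * x ^+ 2 = (2 * x) ^+ 2 by ring.
    rewrite lerXn2r ?nnegrE ?mulr_ge0 // -natrM ler_nat.
    by have := ltn_ord j; lia.
  have : (chord (2 ^+ j.+1 * w))^-1 <= C * (4 * x ^+ 2).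
    rewrite -div1r ler_pdivrMr // (le_trans (hC j.+1)) //.
    by rewrite ler_wpM2r ?chord_ge0 // ler_pM2l.
  by lra.
rewrite (le_trans (ler_sum _ (fun (j : 'I_n) _ => term j))) //.
rewrite sumr_const card_ord -[leLHS]mulr_natl -/x.
have x3 : x ^+ 3 <= (4 * ln N%:R) ^+ 3 by rewrite lerXn2r ?nnegrE //; lra.
have c0 : 0 <= 2 + 8 * C by lra.
have := ler_wpM2l c0 x3; rewrite /even_rate.
have -> : (4 * ln N%:R) ^+ 3 = 64 * ln N%:R ^+ 3 :> R by ring.
have -> : x ^+ 3 = x * x ^+ 2 by rewrite exprS.
lra.
Qed.

Definition correlation_bound rho a w C := forall x, subshift zeta_TM x ->
  forall N, (16 <= N)%N -> normc (twisted_correlation N a w x) <= C * rho N.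

Lemma tm_bounded_correlation rho a w : tm_bounded rho (0%N :: a) w ->
  exists C, correlation_bound rho a w C.
Proof.
move=> [C C0 hC]; exists C => x hx N N16.
have [p ->] := normc_twisted_correlation N a w x hx.
by apply: hC => //; rewrite addKn.
Qed.

Lemma correlation_bound_even_shifts a w : ~~ odd (size a) -> typical w ->
  exists C, correlation_bound odd_rate a w C.
Proof.
move=> oa tw; apply: tm_bounded_correlation.
exact: (tm_bounded_odd _ _ odd_rate_ge1 typical_double tm_bounded_single).
Qed.

Lemma correlation_bound_odd_shifts a w : odd (size a) -> typical w ->
  exists C, correlation_bound even_rate a w C.
Proof.
move=> oa tw; apply: tm_bounded_correlation.
apply: (tm_bounded_even _ _ even_rate_ge1 typical_double tm_bounded_nil tm_bounded_pair) => //.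
by rewrite /= oa.
Qed.

Lemma sorted_filter_iota a : sorted ltn a ->
  a = [seq i <- iota 0 (last 0%N a).+1 | i \in a].
Proof.
move=> sa; apply: (irr_sorted_eq ltn_trans ltnn) => //.
  by apply: sorted_filter; [exact: ltn_trans|exact: iota_ltn_sorted].
move=> i; rewrite mem_filter mem_iota /= add0n ltnS andbC.
case ia : (i \in a); rewrite ?andbF // andbT; symmetry.
have {}sa : sorted leq a by apply: sub_sorted sa => ? ? /ltnW.
have /(nthP 0%N)[j ja <-] := ia; rewrite -nth_last.
have jl : (j <= (size a).-1)%N by case: (size a) ja.
have al : ((size a).-1 < size a)%N by case: (size a) ja.
exact: (sorted_leq_nth leq_trans leqnn 0%N sa) ja al jl.
Qed.

(** An increasing list with last entry [m] is a sublist of [0, ..., m], given by a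
mask; the constant at [m] sums the constants over all masks. *)
Lemma uniform_constant rho : (forall N, (16 <= N)%N -> 1 <= rho N) ->
  exists K : nat -> R -> R, (forall m w, 0 < K m w) /\
  forall a w, sorted ltn a -> (exists C, correlation_bound rho a w C) ->
    correlation_bound rho a w (K (last 0%N a) w).
Proof.
move=> rho1.
pose c a w : R := `|xget 0 [set C | correlation_bound rho a w C]|.
exists (fun m w => 1 + \sum_(b : m.+1.-tuple bool) c (mask b (iota 0 m.+1)) w).
split=> [m w|a w sa].
  by rewrite ltr_pwDl // sumr_ge0 // => b _; exact: normr_ge0.
move=> hC; have {hC} := xgetPex 0 hC; set C := xget _ _ => hC x hx N N16.
rewrite (le_trans (hC x hx N N16)) // ler_wpM2r ?(le_trans ler01 (rho1 N N16)) //.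
set m := last 0%N a.
have sb : size [seq i \in a | i <- iota 0 m.+1] == m.+1 by rewrite size_map size_iota.
rewrite (bigD1 (Tuple sb)) //.
apply: ler_wpDl => //; apply: ler_wpDr.
  by apply: sumr_ge0 => b _; exact: normr_ge0.
rewrite -[mask _ _]/(mask [seq i \in a | i <- iota 0 m.+1] (iota 0 m.+1)).
by rewrite -filter_mask -sorted_filter_iota // ler_norm.
Qed.

End Growth.

(* The implied constant K takes only a_t and w as arguments; last 0 a is a_t
   for t > 0, and 0 (which is not a possible value of a_t) for t = 0. *)
Theorem corollary3p9 (R : realType) :
  (exists B : R, 0 < B /\
   exists K : nat -> R -> R, (forall m w, 0 < K m w) /\
   forall (t : nat) (a : t.-tuple nat),
     ~~ odd t -> sorted ltn a -> all (ltn 0%N) a ->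
     {ae @lebesgue_measure R, forall w : R, w \in `[0, 1[ ->
       forall x : int -> bool, subshift zeta_TM x ->
       forall N : nat, (16 <= N)%N ->
         `|twisted_correlation N a w x| <=
           (K (last 0%N a) w *
             (ln N%:R ^+ (t + 1) *
              expR (B * Num.sqrt (ln N%:R * ln (ln (ln N%:R))))))%:C}) /\
  (forall eps : R, 0 < eps ->
   exists K : nat -> R -> R, (forall m w, 0 < K m w) /\
   forall (t : nat) (a : t.-tuple nat),
     odd t -> sorted ltn a -> all (ltn 0%N) a ->
     {ae @lebesgue_measure R, forall w : R, w \in `[0, 1[ ->
       forall x : int -> bool, subshift zeta_TM x ->
       forall N : nat, (16 <= N)%N ->
         `|twisted_correlation N a w x| <=
           (K (last 0%N a) w * ln N%:R `^ (t%:R + 2 + eps))%:C}).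
Proof.
split.
- exists (192 * 4); split; first by rewrite mulr_gt0 ?ltr0n.
  have [K [K0 hK]] := uniform_constant _ (@odd_rate_ge1 R).
  exists K; split=> // t a ot sa _.
  move: (@ae_typical R); apply: filterS.
    exact: (ae_filter_ringOfSetsType (@lebesgue_measure R)).
  move=> w tw w01 x hx N N16; rewrite normc_norm lecR.
  have ot' : ~~ odd (size a) by rewrite size_tuple.
  have := hK a w sa (correlation_bound_even_shifts a w ot' (tw w01)) x hx N N16.
  move=> /le_trans; apply; rewrite ler_pM2l // /odd_rate ler_wpM2r ?expR_ge0 //.
  by rewrite addn1 ler_eXnr // ln_ge1.
- move=> eps eps0.
  have [K [K0 hK]] := uniform_constant _ (@even_rate_ge1 R).
  exists K; split=> // t a ot sa _.
  move: (@ae_typical R); apply: filterS.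
    exact: (ae_filter_ringOfSetsType (@lebesgue_measure R)).
  move=> w tw w01 x hx N N16; rewrite normc_norm lecR.
  have ot' : odd (size a) by rewrite size_tuple.
  have := hK a w sa (correlation_bound_odd_shifts a w ot' (tw w01)) x hx N N16.
  move=> /le_trans; apply; rewrite ler_pM2l // /even_rate.
  have L1 : 1 <= ln N%:R :> R by exact: ln_ge1.
  rewrite -powR_mulrn; last by lra.
  have t1 : 1 <= t%:R :> R by rewrite ler1n; case: t ot {a sa ot' hK} => [|t].
  by apply: ler_powR => //; lra.
Qed.
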